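(* Let $(W_n)_{n\ge1}\subset\mathcal{W}_{[0,1]}$ and $W_0\in\mathcal{W}_{[0,1]}$ be graphons such that $\|W_n-W_0\|_\Box\to0$. Let $d_n$ and $d_0$ denote the degree functions of $W_n$ and $W_0$ respectively, and assume that $d_0(x)>0$ for almost every $x\in[0,1]$. Let $W_n'$ and $W_0'$ be the normalized kernels of $W_n$ and $W_0$, and $L'_{W_n}$, $L'_{W_0}$ their normalized Laplacians. Then $$\|W_n'-W_0'\|_\Box\to0\quad\text{as } n\to\infty.$$ Moreover, $\|L'_{W_n}-L'_{W_0}\|_{\infty\to1}\to0$ as $n\to\infty$.
   Context: A graphon is a symmetric measurable function $W:[0,1]^2\to[0,1]$; $\mathcal{W}_{[0,1]}$ is the set of graphons. For an integrable symmetric function $U$ on $[0,1]^2$, the cut-norm is $\|U\|_\Box:=\sup_{A,B\subset[0,1]}\left|\int_{A\times B}U(x,y)\,dx\,dy\right|$, the supremum over Lebesgue measurable $A,B$. The degree function of $W$ is $d(x)=\int_0^1W(x,y)\,dy$. The normalized kernel of $W$ is $W'(x,y)=\frac{W(x,y)}{\sqrt{d(x)d(y)}}$ if $d(x),d(y)\neq0$, and $W'(x,y)=0$ otherwise (it is integrable but possibly unbounded). The normalized Laplacian is the operator $L'_W:L^\infty([0,1])\to L^1([0,1])$, $$(L'_Wf)(x)=\mathbf{1}_{d(x)\neq0}\,f(x)-\int_0^1W'(x,y)f(y)\,dy.$$ $\|T\|_{\infty\to1}$ denotes the operator norm of $T:L^\infty([0,1])\to L^1([0,1])$. *)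

(* Defs.v *)
From HB Require Import structures.
From mathcomp Require Import all_boot all_order all_algebra.
From mathcomp Require Import all_classical all_reals all_analysis.
Set Implicit Arguments.
Unset Strict Implicit.
Unset Printing Implicit Defensive.
Import Order.TTheory GRing.Theory Num.Theory.
Import numFieldNormedType.Exports.
Local Open Scope classical_set_scope.
Local Open Scope ring_scope.

(* [R] carries the Borel sigma-algebra by default; [lebT R] is the same carrier
   with the sigma-algebra of Lebesgue measurable sets. *)
Notation lebT R :=
  (caratheodory_type (mu_ext (wlength (@idfun (Real.sort R))))).

Notation borel2 R :=
  ((@lebesgue_measure R) \x (@lebesgue_measure R))%E (only parsing).

(* The plane with the sigma-algebra of Lebesgue measurable sets: the completion
   of the Borel plane (it is larger than the product of two copies of the
   sigma-algebra of [lebT R]). *)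
Notation leb2T R := (caratheodory_type (mu_ext (borel2 R))).

Definition leb2 (R : realType) : {measure set (leb2T R) -> \bar R} :=
  @completed_measure_extension _ _ _ (borel2 R).

Definition unit_itv {R : realType} : set R := `[0, 1]%classic.

Lemma measurable_unit_itv (R : realType) :
  measurable (unit_itv : set (lebT R)).
Proof. by apply: sub_caratheodory; exact: (@measurable_itv R `[0, 1]). Qed.

(* Lebesgue measure on [0, 1], as a measure on the line vanishing outside
   [0, 1]; so functions on [0, 1] are represented by functions on R whose
   values outside [0, 1] are irrelevant. *)
Definition leb01 (R : realType) : {measure set (lebT R) -> \bar R} :=
  mrestr completed_lebesgue_measure (@measurable_unit_itv R).

Record graphon (R : realType) := Graphon {
  graphon_fun :> R * R -> R ;
  graphon_measurable : measurable_fun (unit_itv `*` unit_itv : set (leb2T R))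
    (graphon_fun : leb2T R -> R) ;
  graphon_sym : forall x y : R, unit_itv x -> unit_itv y ->
    graphon_fun (x, y) = graphon_fun (y, x) ;
  graphon_range : forall x y : R, unit_itv x -> unit_itv y ->
    0 <= graphon_fun (x, y) <= 1 }.

(* A supremum in the extended reals: it is finite when [U] is integrable. *)
Definition cut_norm (R : realType) (U : R * R -> R) : \bar R :=
  ereal_sup [set r | exists A B : set (lebT R),
    [/\ measurable A, A `<=` unit_itv, measurable B, B `<=` unit_itv &
        r = `| \int[leb2 R]_(z in A `*` B) (U z)%:E |%E]].

(* The section W(x, _) may be nonmeasurable for a null set of x, where the
   integral takes an irrelevant value. *)
Definition degree (R : realType) (W : R * R -> R) (x : R) : R :=
  \int[leb01 R]_y W (x, y).

Definition normalized_kernel (R : realType) (W : R * R -> R) (z : R * R) : R :=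
  if (degree W z.1 != 0) && (degree W z.2 != 0)
  then W z / Num.sqrt (degree W z.1 * degree W z.2) else 0.

(* The integral is finite for almost every x; elsewhere its value is
   irrelevant. *)
Definition normalized_laplacian (R : realType) (W : R * R -> R)
    (f : R -> R) (x : R) : R :=
  (degree W x != 0)%:R * f x
  - \int[leb01 R]_y (normalized_kernel W (x, y) * f y).

Definition opnorm_infty_1 (R : realType) (T : (R -> R) -> (R -> R)) : \bar R :=
  ereal_sup [set Lnorm (leb01 R) 1 (EFin \o (T f : lebT R -> R)) | f in
    [set f : lebT R -> R | f \in Lfun (leb01 R) +oo%E /\
       (Lnorm (leb01 R) +oo (EFin \o f) <= 1)%E]].

(* Main.v *)
(* The plane and the line carry completed sigma-algebras, while Fubini's theorem
   is available for the Borel product. Since integrals do not see null sets (even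
   for nonmeasurable functions), every graphon is replaced by a symmetric Borel
   function that agrees with it almost everywhere, and every test set or test
   function by a Borel one.

   Write [g = 1 / sqrt d], so that the normalized kernel is [w(x, y) g(x) g(y)].
   - Testing with the sign of [d_n - d_0] gives [\int |d_n - d_0| <= 4 c], where
     [c] is the cut norm of [w_n - w_0]. As [d_0 > 0] almost everywhere, the set
     [L] where [d_n] or [d_0] is below [delta] is small, by Markov's inequality.
   - Off [L], [w_n g_n g_n - w_0 g_0 g_0] is [(w_n - w_0) g_0 g_0], which is
     small in cut norm because the weights are bounded, plus
     [w_n (g_n g_n - g_0 g_0)], which is small in L1 because [1 / sqrt] is
     Lipschitz above [delta].
   - On [L], AM-GM bounds [w g(x) g(y)] by
     [(w g(x)^2 / eps + eps w g(y)^2) / 2], and [\int w(x, y) g(x)^2 dy <= 1];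
     so the integral over [L * [0, 1]] is at most [(|L| / eps + eps) / 2].
   All estimates hold for arbitrary weights [s(x) f(y)] bounded by 1: indicators
   give the cut norm, signs give the operator norm. *)
Require Import Defs.
From HB Require Import structures.
From mathcomp Require Import all_boot all_order all_algebra.
From mathcomp Require Import all_classical all_reals all_analysis.
From mathcomp Require Import measurable_realfun ess_sup_inf ring lra.
Set Implicit Arguments.
Unset Strict Implicit.
Unset Printing Implicit Defensive.
Import Order.TTheory GRing.Theory Num.Theory.
Import numFieldNormedType.Exports.
Local Open Scope classical_set_scope.
Local Open Scope ring_scope.

(** * Fubini's theorem for real integrals, and bounded weights in cut estimates *)

Section integrals_on_a_probability_space.
Context d (T : measurableType d) (R : realType).
Variable P : probability T R.
Implicit Types (f s phi : T -> R) (u : T * T -> R).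

Lemma integrable_bounded d' (X : measurableType d') (Q : probability X R)
    (g : X -> R) (M : R) :
  measurable_fun setT g -> (forall x, `|g x| <= M) ->
  Q.-integrable setT (EFin \o g).
Proof.
move=> mg gM; apply: measurable_bounded_integrable => //.
  by rewrite (le_lt_trans (@probability_le1 _ _ _ Q _ measurableT)) ?ltry.
exists M; split; first exact: num_real.
by move=> y My x _ /=; apply: (le_trans (gM x)); exact: ltW.
Qed.

Lemma ae_eq_integrable d' (X : measurableType d')
    (mu : {measure set X -> \bar R}) (f g : X -> \bar R) :
  measurable_fun setT g -> {ae mu, forall x, f x = g x} ->
  mu.-integrable setT f -> mu.-integrable setT g.
Proof.
move=> mg fg /integrableP[mf foo]; apply/integrableP; split => //.
rewrite (_ : (\int[mu]_x `|g x|)%E = (\int[mu]_x `|f x|)%E)//.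
apply/esym/ae_eq_integral => //; [exact: measurableT_comp..|].
by apply: filterS fg => x /= fg _; rewrite /= fg.
Qed.

Lemma integrable_EFinD d' (X : measurableType d')
    (mu : {measure set X -> \bar R}) (f g : X -> R) :
  mu.-integrable setT (EFin \o f) -> mu.-integrable setT (EFin \o g) ->
  mu.-integrable setT (EFin \o (fun x => f x + g x)).
Proof. by move=> fi gi; exact: (integrableD measurableT fi gi). Qed.

Lemma integrable_EFinB d' (X : measurableType d')
    (mu : {measure set X -> \bar R}) (f g : X -> R) :
  mu.-integrable setT (EFin \o f) -> mu.-integrable setT (EFin \o g) ->
  mu.-integrable setT (EFin \o (fun x => f x - g x)).
Proof. by move=> fi gi; exact: (integrableB measurableT fi gi). Qed.

Lemma integrable_EFinZ d' (X : measurableType d')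
    (mu : {measure set X -> \bar R}) (k : R) (f : X -> R) :
  mu.-integrable setT (EFin \o f) ->
  mu.-integrable setT (EFin \o (fun x => k * f x)).
Proof. by move=> fi; exact: (integrableZl measurableT k fi). Qed.

(** The inner real integral is [fine] of the extended one, so it carries the information of
    [fubini_F] only where the section is integrable. This holds for almost every [x], which suffices
    for the outer integral. *)
Lemma Rintegral_fubini1 u : (P \x P)%E.-integrable setT (EFin \o u) ->
  [/\ {ae P, forall x, P.-integrable setT (fun y => (u (x, y))%:E)},
    P.-integrable setT (fun x => (\int[P]_y u (x, y))%:E) &
    \int[P]_x \int[P]_y u (x, y) = \int[(P \x P)%E]_z u z].
Proof.
move=> iu.
have iF := integrable_fubini_F iu.
have mF : measurable_fun setT (fun x => (\int[P]_y u (x, y))%:E).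
  apply/measurable_EFinP.
  by apply: (measurableT_comp _ (measurable_int _ iF)).
have ae2 : {ae P, forall x, fubini_F P (EFin \o u) x
    = (\int[P]_y u (x, y))%:E}.
  have := ae_integrable1 iu; apply: filterS => x ix.
  by rewrite /fubini_F /Rintegral fineK//; exact: integrable_fin_num ix.
split=> //; [exact: ae_integrable1 iu|exact: ae_eq_integrable iF|].
rewrite /Rintegral -(integral12_prod_meas1 iu); congr fine.
apply/esym/ae_eq_integral => //; first exact: measurable_int iF.
by apply: filterS ae2 => x + _.
Qed.

Lemma Rintegral_fubini2 u : (P \x P)%E.-integrable setT (EFin \o u) ->
  P.-integrable setT (fun y => (\int[P]_x u (x, y))%:E) /\
  \int[P]_y \int[P]_x u (x, y) = \int[(P \x P)%E]_z u z.
Proof.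
move=> iu.
have mu : measurable_fun setT (EFin \o u) := measurable_int _ iu.
(* The modulus of the inner integral is at most the inner integral of [|u|], whose own integral is
   finite by Tonelli. *)
have iG : P.-integrable setT (fubini_G P (EFin \o u)).
  apply/integrableP; split; first exact: measurable_fubini_G iu.
  apply: le_lt_trans ((integrable21ltyP P P mu).1 iu).
  apply: ge0_le_integral => //.
  - by apply: measurableT_comp => //; exact: measurable_fubini_G iu.
  - apply: (measurable_fun_fubini_tonelli_G (abse \o (EFin \o u))).
      exact: measurableT_comp.
    by move=> z; exact: abse_ge0.
  - by move=> y _; apply: le_abse_integral => //; exact: measurableT_comp.
have mG : measurable_fun setT (fun y => (\int[P]_x u (x, y))%:E).
  apply/measurable_EFinP.
  by apply: (measurableT_comp _ (measurable_int _ iG)).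
have ae2 : {ae P, forall y, fubini_G P (EFin \o u) y
    = (\int[P]_x u (x, y))%:E}.
  have := ae_integrable2 iu; apply: filterS => y iy.
  by rewrite /fubini_G /Rintegral fineK//; exact: integrable_fin_num iy.
split=> //; first exact: ae_eq_integrable iG.
rewrite /Rintegral -(integral21_prod_meas1 iu); congr fine.
apply/esym/ae_eq_integral => //; first exact: measurable_int iG.
by apply: filterS ae2 => x + _.
Qed.

Lemma integrable_mul_bounded d' (X : measurableType d')
    (mu : {measure set X -> \bar R}) (s phi : X -> R) (K : R) :
  measurable_fun setT s -> (forall x, `|s x| <= K) ->
  mu.-integrable setT (EFin \o phi) ->
  mu.-integrable setT (fun x => (s x * phi x)%:E).
Proof.
move=> ms sK iphi.
have mphi : measurable_fun setT phi.
  by apply/measurable_EFinP; exact: measurable_int iphi.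
apply: (@le_integrable _ _ _ mu _ measurableT _
    (fun x => K%:E * (`|phi x|)%:E)%E).
- by apply/measurable_EFinP; exact: measurable_funM.
- move=> x _ /=; rewrite lee_fin !normrM normr_id ler_wpM2r//.
  by rewrite (le_trans (sK x))// ler_norm.
- by apply: integrableZl => //; exact: (integrable_abse iphi).
Qed.

(* [\int `|phi|] is the sum of two test integrals, over [0 <= phi] and over its
   complement. *)
Lemma norm_Rintegral_mul_le phi s (c K : R) :
  0 <= K -> P.-integrable setT (EFin \o phi) ->
  (forall A, measurable A -> `|\int[P]_x (\1_A x * phi x)| <= c) ->
  measurable_fun setT s -> (forall x, `|s x| <= K) ->
  `|\int[P]_x (s x * phi x)| <= K * (2 * c).
Proof.
move=> K0 iphi cA ms sK.
have mphi : measurable_fun setT phi.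
  by apply/measurable_EFinP; exact: measurable_int iphi.
have isphi := integrable_mul_bounded ms sK iphi.
apply: (le_trans (le_normr_Rintegral measurableT isphi)).
have mA : measurable [set x | 0 <= phi x].
  rewrite (_ : mkset _ = phi @^-1` `[0, +oo[%classic).
    by rewrite -[X in measurable X]setTI; exact: mphi.
  by apply/seteqP; split => x /=; rewrite in_itv/= andbT.
set A := [set x | 0 <= phi x] in mA.
have i1 (B : set T) : measurable B ->
    P.-integrable setT (fun x => (\1_B x * phi x)%:E).
  move=> mB; apply: (@integrable_mul_bounded _ _ _ _ _ 1) => //.
  by move=> x; rewrite indicE; case: (_ \in _); rewrite ?normr1 ?normr0.
have -> : K * (2 * c) = K * c + K * c by ring.
apply: (@le_trans _ _ (\int[P]_x (K * (\1_A x * phi x) - K * (\1_(~` A) x * phi x)))).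
  apply: le_Rintegral => //.
  - exact: (integrable_norm isphi).
  - apply: integrable_EFinB; apply: integrable_EFinZ; first exact: i1.
    exact: (i1 _ (measurableC mA)).
  - move=> x _; rewrite normrM -mulrBr.
    suff -> : \1_A x * phi x - \1_(~` A) x * phi x = `|phi x|.
      by rewrite ler_wpM2r.
    rewrite !indicE in_setC; case: (boolP (x \in A)) => /= [|/negP].
      by rewrite inE /A/= => h; rewrite ger0_norm// mul1r mul0r subr0.
    rewrite inE /A/= => /negP; rewrite -ltNge => h.
    by rewrite ltr0_norm// mul1r mul0r sub0r.
rewrite RintegralB//; last 2 first.
- by apply: integrable_EFinZ; exact: i1.
- by apply: integrable_EFinZ; exact: (i1 _ (measurableC mA)).
rewrite !RintegralZl//; [|exact: (i1 _ (measurableC mA))|exact: i1].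
have := cA _ mA; have := cA _ (measurableC mA).
rewrite !ler_norml => /andP[h1 _] /andP[_ h2].
by rewrite lerD//; [exact: ler_wpM2l|rewrite -mulrN ler_wpM2l// lerNl].
Qed.

(* Replaces one weight at a time: first [s] against all indicators [\1_B], then
   [f], which costs a factor 2 each. *)
Lemma cut_bound u (c K : R) s f :
  0 <= K -> measurable_fun setT u -> (forall z, `|u z| <= 1) ->
  (forall A B, measurable A -> measurable B ->
    `|\int[(P \x P)%E]_z (\1_A z.1 * \1_B z.2 * u z)| <= c) ->
  measurable_fun setT s -> (forall x, `|s x| <= K) ->
  measurable_fun setT f -> (forall x, `|f x| <= K) ->
  `|\int[(P \x P)%E]_z (s z.1 * f z.2 * u z)| <= 4 * K ^+ 2 * c.
Proof.
move=> K0 mu u1 cAB ms sK mf fK.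
have m1 (g : T -> R) : measurable_fun setT g ->
    measurable_fun setT (fun z : T * T => g z.1).
  by move=> mg; exact: (measurableT_comp mg measurable_fst).
have m2 (g : T -> R) : measurable_fun setT g ->
    measurable_fun setT (fun z : T * T => g z.2).
  by move=> mg; exact: (measurableT_comp mg measurable_snd).
have ind1 (A : set T) x : `|\1_A x| <= 1 :> R.
  by rewrite indicE; case: (_ \in _); rewrite ?normr1 ?normr0.
have gen (g h : T -> R) (k l : R) : measurable_fun setT g ->
   (forall x, `|g x| <= k) -> measurable_fun setT h ->
   (forall x, `|h x| <= l) -> (P \x P)%E.-integrable setT
     (EFin \o (fun z : T * T => g z.1 * h z.2 * u z)).
  move=> mg gk mh hl; apply: (@integrable_bounded _ _ _ _ (k * l * 1)).
    by apply: measurable_funM => //; apply: measurable_funM; [exact: m1|exact: m2].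
  by move=> z; rewrite !normrM !ler_pM// mulr_ge0.
have step1 B : measurable B ->
    `|\int[(P \x P)%E]_z (s z.1 * \1_B z.2 * u z)| <= K * (2 * c).
  move=> mB.
  have iu : (P \x P)%E.-integrable setT
      (EFin \o (fun z : T * T => \1_B z.2 * u z)).
    apply: (@integrable_bounded _ _ _ _ 1).
      by apply: measurable_funM => //; apply: m2; exact: measurable_indic.
    by move=> z; rewrite normrM mulr_ile1.
  have [_ iphi _] := Rintegral_fubini1 iu.
  (* With [B] fixed, the double integral is the integral of the first weight against the function
     [\int \1_B y * u (x, y) dy] of [x], to which [norm_Rintegral_mul_le] applies. *)
  have swap (g : T -> R) (k : R) : measurable_fun setT g ->
      (forall x, `|g x| <= k) ->
      \int[(P \x P)%E]_z (g z.1 * \1_B z.2 * u z) =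
      \int[P]_x (g x * \int[P]_y (\1_B y * u (x, y))).
    move=> mg gk.
    have [_ _ <-] := Rintegral_fubini1 (gen _ _ _ _ mg gk (measurable_indic mB) (ind1 B)).
    apply: eq_Rintegral => x _ /=; under eq_Rintegral do rewrite -mulrA.
    rewrite RintegralZl//; apply: (@integrable_bounded _ _ _ _ 1).
      apply: measurable_funM => //; exact: measurableT_comp mu _.
    by move=> y; rewrite normrM mulr_ile1.
  rewrite (swap _ _ ms sK); apply: norm_Rintegral_mul_le => // A mA.
  by rewrite -(swap _ 1) //; exact: cAB.
have iu : (P \x P)%E.-integrable setT
    (EFin \o (fun z : T * T => s z.1 * u z)).
  apply: (@integrable_bounded _ _ _ _ (K * 1)).
    by apply: measurable_funM => //; exact: m1.
  by move=> z; rewrite normrM ler_pM.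
have [ipsi _] := Rintegral_fubini2 iu.
have swap (g : T -> R) (k : R) : measurable_fun setT g ->
    (forall x, `|g x| <= k) ->
    \int[(P \x P)%E]_z (s z.1 * g z.2 * u z) =
    \int[P]_y (g y * \int[P]_x (s x * u (x, y))).
  move=> mg gk.
  have [_ <-] := Rintegral_fubini2 (gen _ _ _ _ ms sK mg gk).
  apply: eq_Rintegral => y _ /=.
  under eq_Rintegral do rewrite (mulrC (s _)) -mulrA.
  rewrite RintegralZl//; apply: (@integrable_bounded _ _ _ _ (K * 1)).
    apply: measurable_funM => //; exact: measurableT_comp mu _.
  by move=> x; rewrite normrM ler_pM.
rewrite (swap _ _ mf fK).
have -> : 4 * K ^+ 2 * c = K * (2 * (K * (2 * c))) by ring.
apply: norm_Rintegral_mul_le => // B mB.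
by rewrite -(swap _ 1) //; exact: step1.
Qed.

End integrals_on_a_probability_space.

(** * Degrees and normalized kernels on a probability space *)

Section normalized_kernels.
Context d (T : measurableType d) (R : realType).
Variable P : probability T R.
Implicit Types (w : T * T -> R) (a : T -> R).

(** Bounds and symmetry are required at every point, not almost everywhere, so that every section is
    integrable and [deg] is meaningful at every [x]. *)
Definition symmetric_kernel w := [/\ measurable_fun setT w,
  (forall z, 0 <= w z <= 1) & forall x y, w (x, y) = w (y, x)].

Definition deg w (x : T) : R := \int[P]_y w (x, y).

(* The kernel is 0 where a degree vanishes, because [0^-1 = 0]. *)
Definition nker w (z : T * T) : R :=
  w z / (Num.sqrt (deg w z.1) * Num.sqrt (deg w z.2)).

Lemma measurable_comp_fst (a : T -> R) : measurable_fun setT a ->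
  measurable_fun setT (fun z : T * T => a z.1).
Proof. by move=> ma; exact: (measurableT_comp ma measurable_fst). Qed.

Lemma measurable_comp_snd (a : T -> R) : measurable_fun setT a ->
  measurable_fun setT (fun z : T * T => a z.2).
Proof. by move=> ma; exact: (measurableT_comp ma measurable_snd). Qed.

(** Tonelli's theorem, applied in opposite orders to the two sides, gives the same iterated
    integral. *)
Lemma ge0_integral_swap (F : T * T -> \bar R) :
  measurable_fun setT F -> (forall z, 0 <= F z)%E ->
  (\int[P \x P]_z F (z.2, z.1) = \int[P \x P]_z F z)%E.
Proof.
move=> mF F0.
have mF' : measurable_fun setT (fun z : T * T => F (z.2, z.1)).
  by exact: (measurableT_comp mF (@measurable_swap _ _ T T)).
by rewrite fubini_tonelli1// fubini_tonelli2.
Qed.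

Section one_kernel.
Variable w : T * T -> R.
Hypothesis kw : symmetric_kernel w.

Let mw : measurable_fun setT w. Proof. by case: kw. Qed.
Let w01 z : 0 <= w z <= 1. Proof. by case: kw. Qed.
Let w0 z : 0 <= w z. Proof. by case/andP: (w01 z). Qed.
Let w1 z : `|w z| <= 1. Proof. by rewrite ger0_norm//; case/andP: (w01 z). Qed.
Let iw : (P \x P)%E.-integrable setT (EFin \o w).
Proof. exact: (@integrable_bounded _ _ _ _ _ 1). Qed.
Let mwx x : measurable_fun setT (fun y => w (x, y)).
Proof. exact: measurableT_comp. Qed.
Let iwx x : P.-integrable setT (EFin \o (fun y => w (x, y))).
Proof. exact: (@integrable_bounded _ _ _ _ _ 1). Qed.

Lemma degE x : (deg w x)%:E = (\int[P]_y (w (x, y))%:E)%E.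
Proof. by rewrite /deg /Rintegral fineK//; exact: integrable_fin_num (iwx x). Qed.

Lemma measurable_deg : measurable_fun setT (deg w).
Proof.
by case: (Rintegral_fubini1 iw) => _ h _; apply/measurable_EFinP; exact: measurable_int h.
Qed.

Lemma deg_ge0 x : 0 <= deg w x.
Proof. exact: Rintegral_ge0. Qed.

Lemma deg_le1 x : deg w x <= 1.
Proof.
have -> : 1 = \int[P]_y (1 : R).
  by rewrite Rintegral_cst//= probability_setT mulr1.
apply: le_Rintegral => //.
  by apply: (@integrable_bounded _ _ _ _ _ 1) => // ?; rewrite normr1.
by move=> y _; case/andP: (w01 (x, y)).
Qed.

Let g x := (Num.sqrt (deg w x))^-1.

Let mg : measurable_fun setT g.
Proof.
(* The two agree also where the degree vanishes: [0^-1 = 0], and [powR 0] is 0 at a nonzero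
   exponent. *)
rewrite (_ : g = fun x => powR (deg w x) (- 2^-1)).
  by apply: (measurableT_comp (measurable_powR _)); exact: measurable_deg.
by apply/funext => x; rewrite /g powRN powR12_sqrt// deg_ge0.
Qed.

Lemma measurable_nker : measurable_fun setT (nker w).
Proof.
rewrite (_ : nker w = (fun z => w z * (g z.1 * g z.2))).
  apply: measurable_funM => //; apply: measurable_funM.
    exact: measurable_comp_fst.
  exact: measurable_comp_snd.
by apply/funext => z; rewrite /nker invfM.
Qed.

Lemma nker_ge0 z : 0 <= nker w z.
Proof. by rewrite /nker divr_ge0// mulr_ge0// sqrtr_ge0. Qed.

Lemma nkerC x y : nker w (x, y) = nker w (y, x).
Proof. by case: kw => _ _ ws; rewrite /nker ws; congr (_ / _); exact: mulrC. Qed.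

(* [g x ^+ 2 * deg w x] is 1, or 0 where the degree vanishes since [0^-1 = 0]. *)
Let weighted_deg1 a : measurable_fun setT a -> (forall x, 0 <= a x) ->
  (\int[P \x P]_z (a z.1 * g z.1 ^+ 2 * w z)%:E <= \int[P]_x (a x)%:E)%E.
Proof.
move=> ma a0; rewrite fubini_tonelli1; last 2 first.
- apply/measurable_EFinP; apply: measurable_funM => //; apply: measurable_funM.
    exact: measurable_comp_fst.
  by apply: (@measurable_comp_fst (fun x => g x ^+ 2)); exact: measurable_funX.
- by move=> z; rewrite lee_fin mulr_ge0// mulr_ge0// sqr_ge0.
apply: ge0_le_integral => //.
- move=> x _; apply: integral_ge0 => y _.
  by rewrite lee_fin mulr_ge0// mulr_ge0// sqr_ge0.
- apply: measurable_fun_fubini_tonelli_F => [|z].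
    apply/measurable_EFinP; apply: measurable_funM => //; apply: measurable_funM.
      exact: measurable_comp_fst.
    by apply: (@measurable_comp_fst (fun x => g x ^+ 2)); exact: measurable_funX.
  by rewrite lee_fin mulr_ge0// mulr_ge0// sqr_ge0.
- exact/measurable_EFinP.
- move=> x _; rewrite /fubini_F /=.
  under eq_integral do rewrite EFinM.
  rewrite ge0_integralZl//; last 3 first.
  + exact/measurable_EFinP.
  + by move=> y _; rewrite lee_fin.
  + by rewrite lee_fin mulr_ge0// sqr_ge0.
  rewrite -degE -EFinM lee_fin -mulrA ler_piMr// /g exprVn sqr_sqrtr ?deg_ge0//.
  have [->|d0] := eqVneq (deg w x) 0; first by rewrite mulr0.
  by rewrite mulVf.
Qed.

Let weighted_deg2 a : measurable_fun setT a -> (forall x, 0 <= a x) ->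
  (\int[P \x P]_z (a z.2 * g z.2 ^+ 2 * w z)%:E <= \int[P]_x (a x)%:E)%E.
Proof.
move=> ma a0; have := weighted_deg1 ma a0.
rewrite -ge0_integral_swap; last 2 first.
- apply/measurable_EFinP; apply: measurable_funM => //; apply: measurable_funM.
    exact: measurable_comp_fst.
  by apply: (@measurable_comp_fst (fun x => g x ^+ 2)); exact: measurable_funX.
- by move=> z; rewrite lee_fin mulr_ge0// mulr_ge0// sqr_ge0.
apply: le_trans; rewrite le_eqVlt; apply/orP; left; apply/eqP.
apply: eq_integral => -[x y] _ /=.
by case: kw => _ _ ->.
Qed.

(** After AM-GM each term contains the square of a single factor [g], which integration over the
    other variable turns into [g ^+ 2 * deg w <= 1]. The term in [x] contributes [\int a], the term
    in [y] at most 1, so the unbounded kernel has small mass on a small set. *)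
Lemma nker_weight1 a (eps : R) : 0 < eps -> measurable_fun setT a ->
  (forall x, 0 <= a x <= 1) ->
  (\int[P \x P]_z (a z.1 * nker w z)%:E
    <= ((eps^-1 * \int[P]_x a x + eps) / 2)%:E)%E.
Proof.
move=> e0 ma a01.
have a0 x : 0 <= a x by case/andP: (a01 x).
have ia : P.-integrable setT (EFin \o a).
  apply: (@integrable_bounded _ _ _ _ _ 1) => // x.
  by rewrite ger0_norm//; case/andP: (a01 x).
have g2 : measurable_fun setT (fun x => g x ^+ 2) by exact: measurable_funX.
have m1 : measurable_fun setT (fun z : T * T => a z.1 * g z.1 ^+ 2 * w z).
  apply: measurable_funM => //; apply: measurable_funM.
    exact: measurable_comp_fst.
  exact: (measurable_comp_fst g2).
have m2 : measurable_fun setT (fun z : T * T => cst 1 z.2 * g z.2 ^+ 2 * w z).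
  apply: measurable_funM => //; apply: measurable_funM => //.
  exact: (measurable_comp_snd g2).
(* AM-GM: [2 a p q <= a p^2 / eps + eps q^2] for [0 <= a <= 1] *)
apply: (@le_trans _ _ (\int[P \x P]_z ((eps^-1 / 2)%:E * (a z.1 * g z.1 ^+ 2 * w z)%:E +
    (eps / 2)%:E * (cst 1 z.2 * g z.2 ^+ 2 * w z)%:E))%E).
  apply: ge0_le_integral => //.
  - by move=> z _; rewrite lee_fin mulr_ge0// nker_ge0.
  - apply/measurable_EFinP; apply: measurable_funM; last exact: measurable_nker.
    exact: measurable_comp_fst.
  - by apply/measurable_EFinP; apply: measurable_funD; apply: measurable_funM.
  - move=> [x y] _ /=; rewrite lee_fin /nker /= invfM -/(g x) -/(g y).
    have e0' := lt0r_neq0 e0.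
    (* The excess over [a x] times the kernel is a combination of two squares with the nonnegative
       coefficients [a x] and [1 - a x]. *)
    have -> : eps^-1 / 2 * (a x * g x ^+ 2 * w (x, y)) + eps / 2 * (1 * g y ^+ 2 * w (x, y))
      = a x * (w (x, y) * (g x * g y)) + w (x, y) * (a x * (g x - eps * g y) ^+ 2 +
        (1 - a x) * (eps * g y) ^+ 2) * (eps^-1 / 2) by field.
    rewrite lerDl mulr_ge0// ?divr_ge0 ?invr_ge0 ?(ltW e0)//.
    rewrite mulr_ge0// addr_ge0// mulr_ge0 ?sqr_ge0// subr_ge0.
    by case/andP: (a01 x).
have k1 : (0 <= (eps^-1 / 2)%:E)%E by rewrite lee_fin divr_ge0 ?invr_ge0 ?(ltW e0).
have k2 : (0 <= (eps / 2)%:E)%E by rewrite lee_fin divr_ge0 ?(ltW e0).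
have F1 (z : T * T) : (0 <= (a z.1 * g z.1 ^+ 2 * w z)%:E)%E.
  by rewrite lee_fin mulr_ge0// mulr_ge0// sqr_ge0.
have F2 (z : T * T) : (0 <= (cst 1 z.2 * g z.2 ^+ 2 * w z)%:E)%E.
  by rewrite lee_fin mulr_ge0// mulr_ge0 ?sqr_ge0//= ler01.
rewrite ge0_integralD//; last 4 first.
- by move=> z _; exact: mule_ge0.
- by apply/measurable_EFinP; apply: measurable_funM.
- by move=> z _; exact: mule_ge0.
- by apply/measurable_EFinP; apply: measurable_funM.
rewrite !ge0_integralZl//; [|exact/measurable_EFinP..].
have -> : (eps^-1 * \int[P]_x a x + eps) / 2 =
    eps^-1 / 2 * \int[P]_x a x + eps / 2 * 1 by field; exact: lt0r_neq0.
rewrite EFinD !EFinM; apply: leeD; apply: lee_pmul => //.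
- exact: integral_ge0.
- rewrite /Rintegral fineK ?weighted_deg1//.
  exact: integrable_fin_num ia.
- exact: integral_ge0.
- apply: (le_trans (weighted_deg2 _ _)) => //.
  by rewrite -[leLHS]/(\int[P]_x cst 1%E x)%E integral_cst//= probability_setT mule1.
Qed.

Lemma nker_weight2 a (eps : R) : 0 < eps -> measurable_fun setT a ->
  (forall x, 0 <= a x <= 1) ->
  (\int[P \x P]_z (a z.2 * nker w z)%:E
    <= ((eps^-1 * \int[P]_x a x + eps) / 2)%:E)%E.
Proof.
move=> e0 ma a01; have := nker_weight1 e0 ma a01.
rewrite -ge0_integral_swap; last 2 first.
- apply/measurable_EFinP; apply: measurable_funM; last exact: measurable_nker.
  exact: measurable_comp_fst.
- by move=> z; rewrite lee_fin mulr_ge0 ?nker_ge0//; case/andP: (a01 z.1).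
apply: le_trans; rewrite le_eqVlt; apply/orP; left; apply/eqP.
apply: eq_integral => -[x y] _ /=.
by rewrite nkerC.
Qed.

(** The weighted bound with [a = 1] and [eps = 1] shows that the integral is at most 1. *)
Lemma integrable_nker : (P \x P)%E.-integrable setT (EFin \o nker w).
Proof.
apply/integrableP; split; first by apply/measurable_EFinP; exact: measurable_nker.
have c1 (x : T) : 0 <= cst (1 : R) x <= 1.
  by apply/andP; split; [exact: ler01|exact: lexx].
apply: le_lt_trans (ltry _).
apply: le_trans (nker_weight1 ltr01 (measurable_cst (1 : R)) c1).
rewrite le_eqVlt; apply/orP; left; apply/eqP; apply: eq_integral => z _ /=.
by rewrite mul1r ger0_norm// nker_ge0.
Qed.

End one_kernel.
End normalized_kernels.

(** * Lipschitz bounds for inverse square roots away from 0 *)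

Section inverse_square_root.
Variable R : realType.
Implicit Types a b delta : R.

(** With [p], [q], [r] the roots of [a], [b], [delta], the left side is [|p - q| / (p q)] and
    [|a - b| = |p - q| (p + q)], so it is enough that [r^3 <= p q (p + q)]. *)
Lemma inv_sqrt_lipschitz delta a b : 0 < delta -> delta <= a -> delta <= b ->
  `|(Num.sqrt a)^-1 - (Num.sqrt b)^-1| <= `|a - b| / (delta * Num.sqrt delta).
Proof.
move=> d0 da db.
have r0 : 0 < Num.sqrt delta by rewrite sqrtr_gt0.
have ra : Num.sqrt delta <= Num.sqrt a by exact: ler_wsqrtr.
have rb : Num.sqrt delta <= Num.sqrt b by exact: ler_wsqrtr.
have a0 := lt_le_trans r0 ra; have b0 := lt_le_trans r0 rb.
have -> : `|a - b| = `|Num.sqrt a - Num.sqrt b| * (Num.sqrt a + Num.sqrt b).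
  rewrite -[X in _ * X]gtr0_norm ?addr_gt0// -normrM -subr_sqr !sqr_sqrtr//.
    by rewrite ltW// (lt_le_trans d0).
  by rewrite ltW// (lt_le_trans d0).
rewrite -{1}(sqr_sqrtr (ltW d0)).
set p := Num.sqrt a in ra a0 *; set q := Num.sqrt b in rb b0 *.
set r := Num.sqrt delta in r0 ra rb *.
have p0 := lt0r_neq0 a0; have q0 := lt0r_neq0 b0.
have -> : p^-1 - q^-1 = (q - p) * (p * q)^-1   by field; rewrite q0.
rewrite normrM distrC [X in _ * X]gtr0_norm ?invr_gt0 ?mulr_gt0// -mulrA.
apply: ler_wpM2l => //.
rewrite ler_pdivlMr ?mulr_gt0 ?exprn_gt0// mulrC ler_pdivrMr ?mulr_gt0//.
have pq : r ^+ 2 <= p * q by rewrite expr2; apply: ler_pM => //; exact: ltW.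
rewrite mulrC; apply: ler_pM => //; [exact: ltW|by rewrite sqr_ge0|].
by rewrite (le_trans ra)// lerDl ltW.
Qed.

(** One factor is changed at a time; the other is at most [delta^(-1/2)], which with the
    [delta^(-3/2)] of [inv_sqrt_lipschitz] makes [delta^(-2)]. *)
Lemma inv_sqrt2_lipschitz delta a b a' b' : 0 < delta ->
  delta <= a -> delta <= b -> delta <= a' -> delta <= b' ->
  `|(Num.sqrt a * Num.sqrt b)^-1 - (Num.sqrt a' * Num.sqrt b')^-1|
    <= (`|a - a'| + `|b - b'|) / delta ^+ 2.
Proof.
move=> d0 da db da' db'.
have r0 : 0 < Num.sqrt delta by rewrite sqrtr_gt0.
have inv_le e : delta <= e -> `|(Num.sqrt e)^-1| <= (Num.sqrt delta)^-1.
  move=> de; have rb : Num.sqrt delta <= Num.sqrt e.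
    exact: ler_wsqrtr.
  rewrite ger0_norm ?invr_ge0 ?sqrtr_ge0// lef_pV2// posrE//.
  exact: lt_le_trans rb.
have -> : delta ^+ 2 = (delta * Num.sqrt delta) * Num.sqrt delta.
  by rewrite -mulrA -expr2 sqr_sqrtr ?ltW.
rewrite !invfM.
set p := (Num.sqrt a)^-1; set q := (Num.sqrt b)^-1.
set p' := (Num.sqrt a')^-1; set q' := (Num.sqrt b')^-1.
have -> : p * q - p' * q' = (p - p') * q + p' * (q - q') by ring.
apply: (le_trans (ler_normD _ _)); rewrite !normrM mulrDl; apply: lerD.
  rewrite mulrA ler_pM//; last exact: inv_le.
  by rewrite -invfM; exact: inv_sqrt_lipschitz.
rewrite mulrC mulrA ler_pM//; last exact: inv_le.
by rewrite -invfM; exact: inv_sqrt_lipschitz.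
Qed.

End inverse_square_root.

Lemma measurable_sgr d (T : measurableType d) (R : realType) (D : T -> R) :
  measurable_fun setT D -> measurable_fun setT (fun x => Num.sg (D x)).
Proof.
move=> mD; rewrite (_ : (fun x => Num.sg (D x)) =
    (fun x => \1_[set x | 0 < D x] x - \1_[set x | D x < 0] x)).
  apply: measurable_funB; apply: measurable_indic.
    rewrite (_ : mkset _ = D @^-1` `]0, +oo[%classic).
      by rewrite -[X in measurable X]setTI; exact: mD.
    by apply/seteqP; split => x /=; rewrite in_itv/= andbT.
  rewrite (_ : mkset _ = D @^-1` `]-oo, 0[%classic).
    by rewrite -[X in measurable X]setTI; exact: mD.
  by apply/seteqP; split => x /=; rewrite in_itv/=.
apply/funext => x; rewrite !indicE.
case: (ltgtP (D x) 0) => h.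
- rewrite ltr0_sg// memNset/=; last by rewrite ltNge (ltW h).
  by rewrite mem_set//= sub0r.
- rewrite gtr0_sg// mem_set//= memNset/=; last by rewrite ltNge (ltW h).
  by rewrite subr0.
- by rewrite h sgr0 !memNset/= ?h ?ltxx// subr0.
Qed.

Lemma norm_sgr_le1 (R : realType) (x : R) : `|Num.sg x| <= 1.
Proof. by rewrite normr_sg; case: (_ == _). Qed.

(** * Comparison of two kernels that are close in cut norm *)

Section comparison.
Context d (T : measurableType d) (R : realType).
Variable P : probability T R.
Variables w w0 : T * T -> R.
Hypotheses (kw : symmetric_kernel w) (kw0 : symmetric_kernel w0).
Variable c : R.
Hypothesis cut_le : forall A B, measurable A -> measurable B ->
  `|\int[(P \x P)%E]_z (\1_A z.1 * \1_B z.2 * (w z - w0 z))| <= c.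

Let mw : measurable_fun setT w. Proof. by case: kw. Qed.
Let mw0 : measurable_fun setT w0. Proof. by case: kw0. Qed.
Let w01 z : 0 <= w z <= 1. Proof. by case: kw. Qed.
Let w001 z : 0 <= w0 z <= 1. Proof. by case: kw0. Qed.
Let u1 z : `|w z - w0 z| <= 1.
Proof.
case/andP: (w01 z) => ? ?; case/andP: (w001 z) => ? ?.
by rewrite ler_norml; apply/andP; split; lra.
Qed.
Let mu : measurable_fun setT (fun z => w z - w0 z).
Proof. exact: measurable_funB. Qed.

Let D x := deg P w x - deg P w0 x.
Let mD : measurable_fun setT D.
Proof. by apply: measurable_funB; exact: measurable_deg. Qed.
Let D1 x : `|D x| <= 1.
Proof.
have := deg_ge0 P kw x; have := deg_ge0 P kw0 x.
have := deg_le1 P kw x; have := deg_le1 P kw0 x.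
by move=> *; rewrite ler_norml /D; apply/andP; split; lra.
Qed.
Let inD : P.-integrable setT (EFin \o (fun x => `|D x|)).
Proof.
apply: (@integrable_bounded _ _ _ _ _ 1) => [|x]; last by rewrite normr_id.
exact: measurableT_comp.
Qed.

(** The weights [sg (D x)] and 1 turn the tested double integral into [\int |D|]; 4 is the constant
    of [cut_bound] at [K = 1]. *)
Lemma deg_close : \int[P]_x `|deg P w x - deg P w0 x| <= 4 * c.
Proof.
have ms := measurable_sgr mD.
have s1 x : `|Num.sg (D x)| <= 1 := norm_sgr_le1 (D x).
have := cut_bound ler01 mu u1 cut_le ms s1 (measurable_cst (1 : R)) _.
rewrite expr1n mulr1 => h.
apply: le_trans (h _); last by move=> x /=; rewrite normr1.
rewrite le_eqVlt; apply/orP; left; apply/eqP.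
have iu : (P \x P)%E.-integrable setT
    (EFin \o (fun z : T * T => Num.sg (D z.1) * cst 1 z.2 * (w z - w0 z))).
  apply: (@integrable_bounded _ _ _ _ _ 1).
    by apply: measurable_funM => //; apply: measurable_funM => //;
      exact: (measurable_comp_fst ms).
  by move=> z; rewrite normrM mulr_ile1// mulr1.
case: (Rintegral_fubini1 iu) => _ _ <-.
transitivity (\int[P]_x `|D x|); first by [].
rewrite -[LHS]ger0_norm; last exact: Rintegral_ge0.
congr (`|_|); apply: eq_Rintegral => x _ /=.
under eq_Rintegral do rewrite mulr1.
have ikx (v : T * T -> R) : symmetric_kernel v ->
    P.-integrable setT (EFin \o (fun y => v (x, y))).
  case=> mv v01 _; apply: (@integrable_bounded _ _ _ _ _ 1).
    exact: measurableT_comp.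
  by move=> y; case/andP: (v01 (x, y)) => v0 v1; rewrite ger0_norm.
rewrite RintegralZl//; last by apply: integrable_EFinB; exact: ikx.
by rewrite RintegralB//; [exact: normrEsg|exact: ikx|exact: ikx].
Qed.

Variable delta : R.
Hypothesis delta01 : 0 < delta <= 1.
Let delta0 : 0 < delta. Proof. by case/andP: delta01. Qed.

Definition low_degree : set T := [set x | deg P w x < delta \/ deg P w0 x < delta].

Lemma measurable_deg_lt (v : T * T -> R) t : symmetric_kernel v ->
  measurable [set x | deg P v x < t].
Proof.
move=> kv; rewrite (_ : mkset _ = deg P v @^-1` `]-oo, t[%classic).
  by rewrite -[X in measurable X]setTI; exact: measurable_deg.
by apply/seteqP; split => x /=; rewrite in_itv/=.
Qed.

Lemma measurable_low_degree : measurable low_degree.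
Proof. by apply: measurableU; exact: measurable_deg_lt. Qed.

Let iind (A : set T) : measurable A -> P.-integrable setT (EFin \o \1_A).
Proof.
move=> mA; apply: (@integrable_bounded _ _ _ _ _ 1) => // x.
by rewrite indicE; case: (_ \in _); rewrite ?normr1 ?normr0.
Qed.

(** A point of [low_degree] where [w0] has degree at least [2 * delta] has degree below [delta] for
    [w], so the degrees differ there by more than [delta] and Markov's inequality applies. Doubling
    the threshold leaves a first term that depends on [w0] and [delta] only. *)
Lemma low_degree_le :
  \int[P]_x \1_low_degree x
    <= \int[P]_x \1_[set x | deg P w0 x < 2 * delta] x + 4 * c / delta.
Proof.
have mL := measurable_low_degree.
have m2 := @measurable_deg_lt w0 (2 * delta) kw0.
apply: (@le_trans _ _ (\int[P]_x (\1_[set x | deg P w0 x < 2 * delta] x +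
    delta^-1 * `|D x|))).
  apply: le_Rintegral => //; first exact: iind.
    by apply: integrable_EFinD; [exact: iind|exact: integrable_EFinZ].
  move=> x _; rewrite !indicE.
  case: (boolP (x \in low_degree)) => [xL|_] /=; last first.
    by rewrite addr_ge0// mulr_ge0// invr_ge0 ltW.
  case: (boolP (x \in [set x | deg P w0 x < 2 * delta])) => [_|] /=.
    by rewrite lerDl mulr_ge0// invr_ge0 ltW.
  rewrite notin_setE /= => /negP; rewrite -leNgt => h.
  move: xL; rewrite inE => -[h'|h']; last by move: delta0; lra.
  rewrite add0r mulrC ler_pdivlMr// mul1r /D distrC (le_trans _ (ler_norm _))//.
  by lra.
rewrite RintegralD//; [|exact: iind|exact: integrable_EFinZ].
rewrite lerD2l RintegralZl// [leLHS]mulrC ler_wpM2r ?invr_ge0 ?(ltW delta0)//.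
exact: deg_close.
Qed.

Variables (eps : R) (s f : T -> R).
Hypotheses (eps0 : 0 < eps) (ms : measurable_fun setT s)
  (mf : measurable_fun setT f) (s1 : forall x, `|s x| <= 1)
  (f1 : forall x, `|f x| <= 1).

Let L := low_degree.
Let G x : R := \1_(~` L) x.
Let mG : measurable_fun setT G.
Proof. by apply: measurable_indic; apply: measurableC; exact: measurable_low_degree. Qed.
(** The factor [G] cuts the possibly unbounded inverse root off on [L], which leaves a weight
    bounded by [delta^(-1/2)], as [cut_bound] demands. *)
Let g0 x : R := G x * (Num.sqrt (deg P w0 x))^-1.

Let g0_le x : `|g0 x| <= (Num.sqrt delta)^-1.
Proof.
have r0 : 0 < Num.sqrt delta by rewrite sqrtr_gt0.
rewrite /g0 /G indicE in_setC; case: (boolP (x \in L)) => /=.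
  by rewrite mul0r normr0 invr_ge0 ltW.
rewrite notin_setE /L /low_degree /= => /not_orP[_ /negP]; rewrite -leNgt => h.
rewrite mul1r ger0_norm ?invr_ge0 ?sqrtr_ge0// lef_pV2 ?posrE//.
  exact: ler_wsqrtr.
by rewrite sqrtr_gt0 (lt_le_trans delta0).
Qed.

Let mg0 : measurable_fun setT g0.
Proof.
apply: measurable_funM => //.
rewrite (_ : (fun x => _) = fun x => powR (deg P w0 x) (- 2^-1)).
  by apply: (measurableT_comp (measurable_powR _)); exact: measurable_deg.
by apply/funext => x; rewrite powRN powR12_sqrt// deg_ge0.
Qed.

(* Outside [low_degree] in both coordinates [main] has bounded weights and is
   controlled by the cut norm; [rest] dominates everything else pointwise. *)
Let main z := (s z.1 * g0 z.1) * (f z.2 * g0 z.2) * (w z - w0 z).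
Let rest z := (`|D z.1| + `|D z.2|) / delta ^+ 2 +
  (\1_L z.1 + \1_L z.2) * (nker P w z + nker P w0 z).

Let pointwise z :
  `|s z.1 * f z.2 * (nker P w z - nker P w0 z) - main z| <= rest z.
Proof.
have n0 := nker_ge0 P kw z; have n00 := nker_ge0 P kw0 z.
have sf1 : `|s z.1 * f z.2| <= 1 by rewrite normrM mulr_ile1.
have first_ge0 : 0 <= (`|D z.1| + `|D z.2|) / delta ^+ 2.
  by rewrite divr_ge0 ?addr_ge0// exprn_ge0// ltW.
(* If a coordinate lies in [L], then [main] vanishes and the sum of the two kernels is a sufficient
   bound. *)
have bad : (1 <= (\1_L z.1 + \1_L z.2 : R)) -> g0 z.1 * g0 z.2 = 0 ->
    `|s z.1 * f z.2 * (nker P w z - nker P w0 z) - main z| <= rest z.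
  move=> L1 gg.
  have -> : main z = 0.
    rewrite /main (_ : _ * _ * (f z.2 * _) = s z.1 * f z.2 * (g0 z.1 * g0 z.2)).
      by rewrite gg mulr0 mul0r.
    by ring.
  rewrite subr0 normrM (@le_trans _ _ (1 * (nker P w z + nker P w0 z)))//.
    rewrite ler_pM// (le_trans (ler_normB _ _))//.
    by rewrite !ger0_norm.
  by rewrite /rest ler_wpDl// ler_wpM2r// addr_ge0.
have [zL1|zL1] := boolP (z.1 \in L).
  apply: bad; first by rewrite indicE zL1 lerDl indicE.
  by rewrite /g0 /G indicE in_setC zL1 !mul0r.
have [zL2|zL2] := boolP (z.2 \in L).
  apply: bad; first by rewrite addrC indicE zL2 lerDl indicE.
  by rewrite {2}/g0 /G indicE in_setC zL2 mul0r mulr0.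
rewrite /rest !indicE (negbTE zL1) (negbTE zL2)/= addr0 mul0r addr0.
have gE x : x \notin L -> g0 x = (Num.sqrt (deg P w0 x))^-1.
  by move=> xL; rewrite /g0 /G indicE in_setC xL mul1r.
rewrite /main !gE// /nker.
(* Off [L] the terms in [w0 z] cancel, and what remains is [w] times a difference of products of
   inverse roots. *)
have -> : s z.1 * f z.2 * (w z / (Num.sqrt (deg P w z.1) * Num.sqrt (deg P w z.2)) -
     w0 z / (Num.sqrt (deg P w0 z.1) * Num.sqrt (deg P w0 z.2))) -
  s z.1 / Num.sqrt (deg P w0 z.1) * (f z.2 / Num.sqrt (deg P w0 z.2)) * (w z - w0 z)
  = s z.1 * f z.2 * w z * ((Num.sqrt (deg P w z.1) * Num.sqrt (deg P w z.2))^-1 -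
     (Num.sqrt (deg P w0 z.1) * Num.sqrt (deg P w0 z.2))^-1).
  by rewrite !invfM; ring.
rewrite normrM -[leRHS]mul1r ler_pM//.
  rewrite normrM mulr_ile1//.
  by case/andP: (w01 z) => wz0 wz1; rewrite ger0_norm.
have high x : x \notin L -> delta <= deg P w x /\ delta <= deg P w0 x.
  rewrite notin_setE /L /low_degree /= => /not_orP[/negP + /negP].
  by rewrite -!leNgt.
case: (high _ zL1) => ? ?; case: (high _ zL2) => ? ?.
exact: inv_sqrt2_lipschitz.
Qed.

Let iX : (P \x P)%E.-integrable setT
  (EFin \o (fun z : T * T => s z.1 * f z.2 * (nker P w z - nker P w0 z))).
Proof.
apply: (integrable_mul_bounded (K := 1)).
- by apply: measurable_funM; [exact: measurable_comp_fst|exact: measurable_comp_snd].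
- by move=> z; rewrite normrM mulr_ile1.
- by apply: integrable_EFinB; exact: integrable_nker.
Qed.

Let imain : (P \x P)%E.-integrable setT (EFin \o main).
Proof.
apply: (@integrable_bounded _ _ _ _ _
  ((1 * (Num.sqrt delta)^-1) * (1 * (Num.sqrt delta)^-1) * 1)).
  apply: measurable_funM => //; apply: measurable_funM.
    by apply: (@measurable_comp_fst _ _ _ (fun x => s x * g0 x)); exact: measurable_funM.
  by apply: (@measurable_comp_snd _ _ _ (fun x => f x * g0 x)); exact: measurable_funM.
move=> z; rewrite /main normrM; apply: ler_pM => //.
by rewrite normrM; apply: ler_pM => //; rewrite normrM; apply: ler_pM.
Qed.

Let main_le : `|\int[(P \x P)%E]_z main z| <= 4 * c / delta.
Proof.
have -> : 4 * c / delta = 4 * (Num.sqrt delta)^-1 ^+ 2 * c.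
  by rewrite exprVn sqr_sqrtr ?(ltW delta0)// mulrAC.
apply: (cut_bound (s := fun x => s x * g0 x) (f := fun x => f x * g0 x)
  _ mu u1 cut_le).
- by rewrite invr_ge0 sqrtr_ge0.
- exact: (measurable_funM ms mg0).
- by move=> x; rewrite normrM -[leRHS]mul1r ler_pM.
- exact: (measurable_funM mf mg0).
- by move=> x; rewrite normrM -[leRHS]mul1r ler_pM.
Qed.

Let iD1 : (P \x P)%E.-integrable setT (EFin \o (fun z : T * T => `|D z.1|)).
Proof.
apply: (@integrable_bounded _ _ _ _ _ 1) => [|z]; last by rewrite normr_id.
by apply: (@measurable_comp_fst _ _ _ (fun x => `|D x|)); exact: measurableT_comp.
Qed.

Let iD2 : (P \x P)%E.-integrable setT (EFin \o (fun z : T * T => `|D z.2|)).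
Proof.
apply: (@integrable_bounded _ _ _ _ _ 1) => [|z]; last by rewrite normr_id.
by apply: (@measurable_comp_snd _ _ _ (fun x => `|D x|)); exact: measurableT_comp.
Qed.

Let int_D1 : \int[(P \x P)%E]_z `|D z.1| <= 4 * c.
Proof.
case: (Rintegral_fubini1 iD1) => _ _ <-.
apply: le_trans deg_close; rewrite le_eqVlt; apply/orP; left; apply/eqP.
apply: eq_Rintegral => x _ /=.
by apply: (etrans (Rintegral_cst P measurableT _)); rewrite [X in fine X]probability_setT mulr1.
Qed.

Let int_D2 : \int[(P \x P)%E]_z `|D z.2| <= 4 * c.
Proof.
case: (Rintegral_fubini1 iD2) => _ _ <-.
apply: le_trans deg_close; rewrite le_eqVlt; apply/orP; left; apply/eqP.
by apply: (etrans (Rintegral_cst P measurableT (\int[P]_y `|D y|)));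
  rewrite [X in fine X]probability_setT mulr1.
Qed.

Let L01 x : 0 <= (\1_L x : R) <= 1.
Proof. by rewrite indicE; case: (_ \in _); rewrite /= ?ler01 ?lexx. Qed.

Let mL : measurable_fun setT (\1_L : T -> R).
Proof. by apply: measurable_indic; exact: measurable_low_degree. Qed.

Let bound := (eps^-1 * \int[P]_x \1_L x + eps) / 2.

Let fine_le_bound (F : T * T -> R) : (P \x P)%E.-integrable setT (EFin \o F) ->
  (\int[P \x P]_z (F z)%:E <= bound%:E)%E -> \int[(P \x P)%E]_z F z <= bound.
Proof.
by move=> iF; rewrite -lee_fin /Rintegral fineK//; exact: integrable_fin_num iF.
Qed.

Let iL1 v : symmetric_kernel v ->
  (P \x P)%E.-integrable setT (EFin \o (fun z : T * T => \1_L z.1 * nker P v z)).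
Proof.
move=> kv; apply: (integrable_mul_bounded (K := 1)).
- exact: (measurable_comp_fst mL).
- by move=> z; case/andP: (L01 z.1) => ? ?; rewrite ger0_norm.
- exact: integrable_nker.
Qed.

Let iL2 v : symmetric_kernel v ->
  (P \x P)%E.-integrable setT (EFin \o (fun z : T * T => \1_L z.2 * nker P v z)).
Proof.
move=> kv; apply: (integrable_mul_bounded (K := 1)).
- exact: (measurable_comp_snd mL).
- by move=> z; case/andP: (L01 z.2) => ? ?; rewrite ger0_norm.
- exact: integrable_nker.
Qed.

Let int_L1 v : symmetric_kernel v ->
  \int[(P \x P)%E]_z (\1_L z.1 * nker P v z) <= bound.
Proof. by move=> kv; apply: fine_le_bound; [exact: iL1|exact: nker_weight1]. Qed.

Let int_L2 v : symmetric_kernel v ->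
  \int[(P \x P)%E]_z (\1_L z.2 * nker P v z) <= bound.
Proof. by move=> kv; apply: fine_le_bound; [exact: iL2|exact: nker_weight2]. Qed.

(** The first term bounds [main], by [cut_bound] at [K = delta^(-1/2)]. The second comes from
    [|D z.1|] and [|D z.2|], each of integral at most [4 * c]. The third is four times [bound], for
    two kernels and two coordinates in [L]. *)
Lemma nker_close :
  `|\int[(P \x P)%E]_z (s z.1 * f z.2 * (nker P w z - nker P w0 z))| <=
  4 * c / delta + 8 * c / delta ^+ 2 +
  2 * (eps^-1 * \int[P]_x \1_low_degree x + eps).
Proof.
pose rest1 z := delta ^- 2 * (`|D z.1| + `|D z.2|).
pose rest2 z := \1_L z.1 * nker P w z + \1_L z.2 * nker P w z +
  (\1_L z.1 * nker P w0 z + \1_L z.2 * nker P w0 z).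
have restE z : rest z = rest1 z + rest2 z by rewrite /rest /rest1 /rest2; ring.
have ir1 : (P \x P)%E.-integrable setT (EFin \o rest1).
  by apply: integrable_EFinZ; exact: integrable_EFinD.
have irw v : symmetric_kernel v -> (P \x P)%E.-integrable setT
    (EFin \o (fun z => \1_L z.1 * nker P v z + \1_L z.2 * nker P v z)).
  by move=> kv; apply: integrable_EFinD; [exact: iL1|exact: iL2].
have ir2 : (P \x P)%E.-integrable setT (EFin \o rest2).
  by apply: integrable_EFinD; exact: irw.
pose X (z : T * T) := s z.1 * f z.2 * (nker P w z - nker P w0 z).
have -> : \int[(P \x P)%E]_z (s z.1 * f z.2 * (nker P w z - nker P w0 z)) =
    \int[(P \x P)%E]_z main z + \int[(P \x P)%E]_z (X z - main z).
  by rewrite RintegralB// addrC subrK.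
rewrite -addrA (le_trans (ler_normD _ _))// lerD//.
have iXm : (P \x P)%E.-integrable setT (EFin \o (fun z => X z - main z)).
  exact: integrable_EFinB.
apply: (le_trans (le_normr_Rintegral measurableT iXm)).
apply: (@le_trans _ _ (\int[(P \x P)%E]_z (rest1 z + rest2 z))).
  apply: le_Rintegral => //; first exact: (integrable_norm iXm).
    exact: integrable_EFinD.
  by move=> z _; rewrite -restE; exact: pointwise.
rewrite RintegralD//; apply: lerD.
  rewrite RintegralZl//; last exact: integrable_EFinD.
  rewrite RintegralD// mulrC ler_wpM2r ?invr_ge0 ?exprn_ge0 ?(ltW delta0)//.
  by rewrite (le_trans (lerD int_D1 int_D2))//; lra.
rewrite RintegralD//; [|exact: irw|exact: irw].
rewrite !RintegralD//; [|exact: iL1|exact: iL2|exact: iL1|exact: iL2].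
apply: (@le_trans _ _ ((bound + bound) + (bound + bound))).
  by apply: lerD; apply: lerD; [exact: int_L1|exact: int_L2|exact: int_L1|exact: int_L2].
by rewrite /bound; lra.
Qed.

End comparison.

(** * L1 estimates and the choice of parameters in the limit *)

Section limits.
Context d (T : measurableType d) (R : realType).
Variable P : probability T R.

(** The sign of the inner integral is taken as the weight [s] in [nker_close], which turns the
    bilinear bound into a bound in L1, uniform in [f]. *)
Lemma nker_close_L1 (w w0 : T * T -> R) (c delta eps : R) (f : T -> R) :
  symmetric_kernel w -> symmetric_kernel w0 ->
  (forall A B, measurable A -> measurable B ->
    `|\int[(P \x P)%E]_z (\1_A z.1 * \1_B z.2 * (w z - w0 z))| <= c) ->
  0 < delta <= 1 -> 0 < eps -> measurable_fun setT f ->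
  (forall x, `|f x| <= 1) ->
  [/\ P.-integrable setT (fun x =>
      (\int[P]_y ((nker P w (x, y) - nker P w0 (x, y)) * f y))%:E) &
  \int[P]_x `|\int[P]_y ((nker P w (x, y) - nker P w0 (x, y)) * f y)| <=
  4 * c / delta + 8 * c / delta ^+ 2 +
  2 * (eps^-1 * \int[P]_x \1_(low_degree P w w0 delta) x + eps)].
Proof.
move=> kw kw0 cut_le d01 e0 mf f1.
have inn : (P \x P)%E.-integrable setT
    (EFin \o (fun z => nker P w z - nker P w0 z)).
  by apply: integrable_EFinB; exact: integrable_nker.
have inf : (P \x P)%E.-integrable setT
    (EFin \o (fun z : T * T => (nker P w z - nker P w0 z) * f z.2)).
  rewrite (_ : (fun z => _) = (fun z : T * T => f z.2 * (nker P w z - nker P w0 z))).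
    by apply: (integrable_mul_bounded (K := 1) (measurable_comp_snd mf) _ inn).
  by apply/funext => z; rewrite mulrC.
case: (Rintegral_fubini1 inf) => inx iphi _.
pose phi x := \int[P]_y ((nker P w (x, y) - nker P w0 (x, y)) * f y).
split; first exact: iphi.
rewrite -[leLHS]/(\int[P]_x `|phi x|).
have {}iphi : P.-integrable setT (EFin \o phi) := iphi.
have mphi : measurable_fun setT phi by apply/measurable_EFinP; exact: measurable_int iphi.
have ms := measurable_sgr mphi.
have s1 x : `|Num.sg (phi x)| <= 1 := norm_sgr_le1 _.
apply: le_trans (nker_close kw kw0 cut_le d01 e0 ms mf s1 f1).
apply: le_trans (ler_norm _); rewrite le_eqVlt; apply/orP; left; apply/eqP.
have isf : (P \x P)%E.-integrable setT (EFin \o (fun z : T * T =>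
    Num.sg (phi z.1) * f z.2 * (nker P w z - nker P w0 z))).
  apply: (integrable_mul_bounded (K := 1)
    (s := fun z : T * T => Num.sg (phi z.1) * f z.2) _ _ inn).
    by apply: measurable_funM; [exact: (measurable_comp_fst ms)|exact: measurable_comp_snd].
  by move=> z; rewrite normrM mulr_ile1.
case: (Rintegral_fubini1 isf) => _ iG <-.
rewrite /Rintegral; congr fine; apply: ae_eq_integral => //.
- by apply/measurable_EFinP; exact: measurableT_comp.
- exact: measurable_int iG.
(* The sign is moved into the inner integral where the section is integrable, that is for almost
   every [x]. *)
- apply: filterS inx => x ix _ /=; rewrite normrEsg; congr EFin.
  transitivity (\int[P]_y (Num.sg (phi x) *
      ((nker P w (x, y) - nker P w0 (x, y)) * f y))).
    by rewrite RintegralZl.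
  by apply: eq_Rintegral => y _ /=; ring.
Qed.

(** The two kernel integrals are merged into one. For bounded measurable [f] this is the difference
    of the two Laplacians at each [x] where both kernel sections are integrable. *)
Definition laplacian_diff (w w0 : T * T -> R) (f : T -> R) (x : T) : R :=
  ((deg P w x != 0)%:R - (deg P w0 x != 0)%:R) * f x
  - \int[P]_y ((nker P w (x, y) - nker P w0 (x, y)) * f y).

Lemma measurable_neq0 (h : T -> R) : measurable_fun setT h ->
  measurable_fun setT (fun x => (h x != 0)%:R : R).
Proof.
move=> mh; rewrite (_ : (fun x => _) = \1_(h @^-1` [set~ 0])).
  apply: measurable_indic; rewrite -[X in measurable X]setTI; apply: mh => //.
  by apply: measurableC; exact: measurable_set1.
apply/funext => x; rewrite indicE; congr (nat_of_bool _)%:R.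
by apply/idP/idP => [/eqP h0|]; [rewrite inE|rewrite inE => /eqP].
Qed.

(** The two multiplication parts can differ only where a degree vanishes, hence inside [low_degree],
    whose measure is the extra term; [nker_close_L1] bounds the integral part. *)
Lemma laplacian_diff_L1 (w w0 : T * T -> R) (c delta eps : R) (f : T -> R) :
  symmetric_kernel w -> symmetric_kernel w0 ->
  (forall A B, measurable A -> measurable B ->
    `|\int[(P \x P)%E]_z (\1_A z.1 * \1_B z.2 * (w z - w0 z))| <= c) ->
  0 < delta <= 1 -> 0 < eps -> measurable_fun setT f ->
  (forall x, `|f x| <= 1) ->
  P.-integrable setT (fun x => (laplacian_diff w w0 f x)%:E) /\
  \int[P]_x `|laplacian_diff w w0 f x| <=
  \int[P]_x \1_(low_degree P w w0 delta) x +
  (4 * c / delta + 8 * c / delta ^+ 2 +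
  2 * (eps^-1 * \int[P]_x \1_(low_degree P w w0 delta) x + eps)).
Proof.
move=> kw kw0 cut_le d01 e0 mf f1.
have [iphi phi_le] := nker_close_L1 kw kw0 cut_le d01 e0 mf f1.
pose phi x := \int[P]_y ((nker P w (x, y) - nker P w0 (x, y)) * f y).
have {}iphi : P.-integrable setT (EFin \o phi) := iphi.
rewrite -[X in X <= _]/(\int[P]_x `|phi x|) in phi_le.
set L := low_degree _ _ _ _ in phi_le *.
have mL : measurable L by exact: measurable_low_degree.
have iL : P.-integrable setT (EFin \o (\1_L : T -> R)).
  apply: (@integrable_bounded _ _ _ _ _ 1) => // x.
  by rewrite indicE; case: (_ \in _); rewrite ?normr1 ?normr0.
pose dif x : R := ((deg P w x != 0)%:R - (deg P w0 x != 0)%:R) * f x.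
have dif_le x : `|dif x| <= 1.
  rewrite normrM mulr_ile1//.
  by case: (_ != _); case: (_ != _); rewrite ?subrr ?subr0 ?sub0r ?normrN ?normr1 ?normr0.
have difL x : `|dif x| <= \1_L x.
  rewrite indicE; case: (boolP (x \in L)) => xL /=; first exact: dif_le.
  move: xL; rewrite notin_setE /L /low_degree /= => /not_orP[/negP + /negP].
  rewrite -!leNgt; case/andP: d01 => d0 _ h h'.
  by rewrite /dif !(@gt_eqF _ _ _ 0) ?subrr ?mul0r ?normr0//; exact: lt_le_trans d0 _.
have mdif : measurable_fun setT dif.
  apply: measurable_funM => //; apply: measurable_funB; apply: measurable_neq0;
    exact: measurable_deg.
have idif := @integrable_bounded _ _ _ P dif 1 mdif dif_le.
have itot := integrable_EFinB idif iphi.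
split; first exact: itot.
apply: (@le_trans _ _ (\int[P]_x (\1_L x + `|phi x|))).
  apply: le_Rintegral => //; first exact: (integrable_norm itot).
    by apply: integrable_EFinD => //; exact: (integrable_norm iphi).
  by move=> x _; rewrite (le_trans (ler_normB _ _))// lerD2r difL.
rewrite RintegralD//; last exact: (integrable_norm iphi).
by rewrite lerD2l.
Qed.

(** The sets where the degree is below [1 / (k + 1)] decrease to a null set, because the degree is
    positive almost everywhere; continuity from above makes one of them small. *)
Lemma small_degree_small (w0 : T * T -> R) (t : R) : symmetric_kernel w0 ->
  {ae P, forall x, 0 < deg P w0 x} -> 0 < t ->
  exists2 delta : R, 0 < delta <= 1 &
    \int[P]_x \1_[set x | deg P w0 x < 2 * delta] x <= t.
Proof.
move=> kw0 deg0 t0.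
pose F (k : nat) := [set x | deg P w0 x < k.+1%:R^-1].
have mF k : measurable (F k) by exact: measurable_deg_lt.
have capF : P (\bigcap_k F k) = 0%E.
  apply/negligibleP; first exact: bigcap_measurable.
  apply: negligibleS deg0 => x /= Fx; apply/negP; rewrite -leNgt.
  rewrite leNgt; apply/negP => /ltr_add_invr[k]; rewrite add0r => kx.
  by have := Fx k I; rewrite /F /= ltNge (ltW kx).
have : P \o F @ \oo --> P (\bigcap_k F k).
  apply: nonincreasing_cvg_mu => //.
  - by rewrite (le_lt_trans (probability_le1 _ _)) ?ltry.
  - exact: bigcap_measurable.
  - move=> m n mn; apply/subsetPset => x; rewrite /F /= => /lt_le_trans; apply.
    by rewrite lef_pV2 ?posrE// ler_nat ltnS.
rewrite capF => /fine_cvgP[_] /cvgrPdist_le /(_ _ t0)[N _ /(_ N (leqnn N))].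
rewrite /= sub0r normrN => hN.
(* Half the level found, since the conclusion concerns [2 * delta]. *)
exists (N.+1%:R^-1 / 2).
  rewrite divr_gt0 ?invr_gt0//= ler_pdivrMr// mul1r.
  by rewrite (@le_trans _ _ 1) ?invf_le1 ?ler1n//.
rewrite mulrC divfK// /Rintegral integral_indic ?setIT//; last exact: mF.
exact: le_trans (ler_norm _) hN.
Qed.

(** The parameters are chosen in the order [eps], [delta], [c], before [n]; only the bound [c] on
    the cut integrals depends on [n] being large. *)
Lemma normalized_limit (w : nat -> T * T -> R) (w0 : T * T -> R) :
  (forall n, symmetric_kernel (w n)) -> symmetric_kernel w0 ->
  (forall c, 0 < c -> \forall n \near \oo,
    forall A B, measurable A -> measurable B ->
    `|\int[(P \x P)%E]_z (\1_A z.1 * \1_B z.2 * (w n z - w0 z))| <= c) ->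
  {ae P, forall x, 0 < deg P w0 x} ->
  forall e, 0 < e -> \forall n \near \oo,
    (forall s f : T -> R, measurable_fun setT s -> measurable_fun setT f ->
      (forall x, `|s x| <= 1) -> (forall x, `|f x| <= 1) ->
      `|\int[(P \x P)%E]_z (s z.1 * f z.2 * (nker P (w n) z - nker P w0 z))| <= e) /\
    (forall f : T -> R, measurable_fun setT f -> (forall x, `|f x| <= 1) ->
      P.-integrable setT (EFin \o laplacian_diff (w n) w0 f) /\
      \int[P]_x `|laplacian_diff (w n) w0 f x| <= e).
Proof.
move=> kw kw0 cut0 deg0.
(* The bound for the Laplacians exceeds the bilinear one by the measure of [low_degree], so one
   choice serves both. Passing to [min e 1] gives [e <= 1], hence [eps ^+ 2 <= eps] below. *)
suff small e : 0 < e -> e <= 1 -> \forall n \near \oo,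
    exists delta eps c : R, [/\ 0 < delta <= 1, 0 < eps,
    forall A B, measurable A -> measurable B ->
    `|\int[(P \x P)%E]_z (\1_A z.1 * \1_B z.2 * (w n z - w0 z))| <= c &
    \int[P]_x \1_(low_degree P (w n) w0 delta) x +
    (4 * c / delta + 8 * c / delta ^+ 2 +
    2 * (eps^-1 * \int[P]_x \1_(low_degree P (w n) w0 delta) x + eps)) <= e].
  move=> e e0; have m0 : 0 < Num.min e 1 by rewrite lt_min e0 ltr01.
  have m1 : Num.min e 1 <= 1 by rewrite ge_min lexx orbT.
  have me : Num.min e 1 <= e by rewrite ge_min lexx.
  apply: filterS (small _ m0 m1) => n [delta [eps [c [d01 e0' cut_le le_e]]]].
  split => [s f ms mf s1 f1|f mf f1].
    apply: le_trans (nker_close (kw n) kw0 cut_le d01 e0' ms mf s1 f1) _.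
    apply: le_trans me; apply: le_trans le_e; rewrite lerDr.
    by apply: Rintegral_ge0 => x _; rewrite indicE.
  have [ild ld] := laplacian_diff_L1 (kw n) kw0 cut_le d01 e0' mf f1.
  by split; [exact: ild|exact: le_trans ld (le_trans le_e me)].
move=> e0 e1.
(* The total is at most [5 * eps + K * c], that is [5 e / 16 + e / 2 < e]. *)
have [eps [eps0 epsE]] : exists eps : R, 0 < eps /\ 16 * eps = e.
  by exists (e / 16); split; [rewrite divr_gt0|rewrite mulrC divfK].
(* The level [eps ^+ 2] survives the later division by [eps]. *)
have [delta d01 q_le] := small_degree_small kw0 deg0 (exprn_gt0 2 eps0).
have d0 : 0 < delta by case/andP: d01.
set q := \int[P]_x _ in q_le.
(* [K] gathers all coefficients of [c]: the first and last come from [low_degree_le], the others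
   from [nker_close]. *)
pose K := 4 / delta + (4 / delta + 8 / delta ^+ 2 + 8 / (delta * eps)).
have K0 : 0 < K by rewrite !addr_gt0// divr_gt0// ?exprn_gt0// mulr_gt0.
have [c [c0 KC]] : exists c, 0 < c /\ K * c = e / 2.
  exists (e / (2 * K)); split; first by rewrite divr_gt0// mulr_gt0.
  by rewrite invfM mulrCA [K * _]mulrCA mulfV ?mulr1// lt0r_neq0.
apply: filterS (cut0 _ c0) => n cut_le.
exists delta, eps, c; split => //.
have := low_degree_le (kw n) kw0 cut_le d01; rewrite -/q.
set p := \int[P]_x _ => p_le.
have ep : eps^-1 * p <= eps + 4 * c / (delta * eps).
  rewrite mulrC ler_pdivrMr// mulrDl -expr2 (le_trans p_le)// lerD//.
  by rewrite invfM mulrA mulfVK// lt0r_neq0.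
have p2 : p <= eps + 4 * c / delta.
  rewrite (le_trans p_le)// lerD2r (le_trans q_le)// expr2 ler_piMl ?(ltW eps0)//.
  by move: epsE e1; lra.
have KE : K * c = 4 * c / delta + (4 * c / delta + 8 * c / delta ^+ 2
   + 2 * (4 * c / (delta * eps))) by rewrite /K; ring.
have : p + (4 * c / delta + 8 * c / delta ^+ 2 + 2 * (eps^-1 * p + eps))
  <= 5 * eps + K * c by rewrite KE; lra.
by move/le_trans; apply; move: KC epsE; lra.
Qed.

End limits.

(** * Integrals and measurability up to null sets *)

Section integrals_of_arbitrary_functions.
Import HBNNSimple.

(* [f] and [g] need not be measurable: the integral of a nonnegative
   function is a supremum over the simple functions below it, and these can be
   set to zero on a null set. *)
Lemma ae_eq_integral_nonmeasurable d (T : measurableType d) (R : realType)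
    (mu : {measure set T -> \bar R}) (f g : T -> \bar R) :
  {ae mu, forall x, f x = g x} -> (\int[mu]_x f x = \int[mu]_x g x)%E.
Proof.
have le (h k : T -> \bar R) : (forall x, 0 <= h x)%E -> (forall x, 0 <= k x)%E ->
    {ae mu, forall x, h x = k x} -> (\int[mu]_x h x <= \int[mu]_x k x)%E.
  move=> h0 k0 [N [mN N0 hkN]].
  rewrite !ge0_integralTE//; apply: ge_ereal_sup => _ [/= s sh <-].
  apply: ereal_sup_ubound; exists (mul_nnsfun s (indic_nnsfun R (measurableC mN))).
    move=> x /=; rewrite mindicE in_setC; case: (boolP (x \in N)) => xN /=.
      by rewrite mulr0.
    rewrite mulr1 (le_trans (sh x))//.
    suff -> : h x = k x by [].
    by apply: contrapT => hk; move/negP: xN; apply; rewrite inE; exact: hkN.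
  rewrite -!integralT_nnsfun; apply: ae_eq_integral => //.
  - exact/measurable_EFinP.
  - exact/measurable_EFinP.
  - exists N; split => // x /= /not_implyP[_ hx]; apply: contrapT => xN; apply: hx.
    by rewrite /= mindicE in_setC memNset//= mulr1.
have eq (h k : T -> \bar R) : (forall x, 0 <= h x)%E -> (forall x, 0 <= k x)%E ->
    {ae mu, forall x, h x = k x} -> (\int[mu]_x h x = \int[mu]_x k x)%E.
  move=> h0 k0 hk; apply/eqP; rewrite eq_le !le//.
  by apply: filterS hk => x ->.
move=> fg; rewrite (integralE mu setT f) (integralE mu setT g).
by congr (_ - _)%E; apply: eq => //; apply: filterS fg => x fgx;
  rewrite !(funeposE, funenegE) fgx.
Qed.

End integrals_of_arbitrary_functions.

(** Used with [phi] the identity from a completed sigma-algebra to the Borel one: a Borel function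
    has the same integral for a measure and for its completion. *)
Lemma integral_comp_measure d d' (X : measurableType d) (Y : measurableType d')
    (R : realType) (phi : X -> Y) (m : {measure set X -> \bar R})
    (m' : {measure set Y -> \bar R}) (f : Y -> \bar R) :
  measurable_fun setT phi ->
  (forall B, measurable B -> m' B = m (phi @^-1` B)) ->
  measurable_fun setT f ->
  (\int[m']_y f y = \int[m]_x f (phi x))%E.
Proof.
move=> mphi m'E mf.
have ge0 (h : Y -> \bar R) : measurable_fun setT h -> (forall y, 0 <= h y)%E ->
    (\int[m']_y h y = \int[m]_x h (phi x))%E.
  move=> mh h0.
  have := @ge0_integral_pushforward _ _ _ _ R phi mphi m setT h measurableT mh.
  rewrite preimage_setT => <-; last by move=> y _; exact: h0.
  by apply: eq_measure_integral => A mA _; rewrite m'E.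
rewrite (integralE m') (integralE m) !ge0//.
- by congr (_ - _)%E; apply: eq_integral => x _; rewrite !(funeposE, funenegE).
- exact: measurable_funeneg.
- exact: measurable_funepos.
Qed.

(* One null set serves all levels [r]: the rational levels determine the rest. *)
Lemma ae_measurable_restriction d (T : measurableType d) (R : realType)
    (mu : {measure set T -> \bar R}) (D : set T) (f : T -> R) :
  (forall r, exists N, [/\ measurable N, mu N = 0%E &
    measurable ((D `&` [set x | r < f x]) `\` N)]) ->
  exists N, [/\ measurable N, mu N = 0%E &
    forall r, measurable ((D `&` [set x | r < f x]) `\` N)].
Proof.
move=> h.
have /choice[N NP] (q : rat) := h (ratr q).
(* The null sets of the rational levels are enumerated by [nat], so that their union is a null
   set. *)
pose M (n : nat) := if unpickle n is Some q then N q else set0.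
have mM n : measurable (M n) by rewrite /M; case: unpickle => // q; case: (NP q).
have M0 n : mu (M n) = 0%E.
  by rewrite /M; case: unpickle => [q|]; [case: (NP q)|exact: measure0].
have mUM : measurable (\bigcup_n M n) by exact: bigcupT_measurable.
have NM q : N q `<=` \bigcup_n M n.
  have -> : N q = M (pickle q) by rewrite /M pickleK.
  by move: (pickle q) => n; exact: bigcup_sup.
exists (\bigcup_n M n); split => //.
  apply/negligibleP; [exact: mUM|]; apply: negligible_bigcup => n.
  by apply/negligibleP; [exact: mM|exact: M0].
move=> r.
pose F (q : rat) : set T := if r < ratr q then
  ((D `&` [set x | ratr q < f x]) `\` N q) `\` \bigcup_n M n else set0.
rewrite (_ : _ `\` _ = \bigcup_q F q).
  apply: bigcupT_measurable_rat => q; rewrite /F; case: ifPn => // _.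
  by apply: measurableD => //; case: (NP q).
apply/seteqP; split => [x [[Dx /= /rat_in_itvoo[q]]]|x [q _]].
  rewrite in_itv/= => /andP[rq qf] nM; exists q => //; rewrite /F rq.
  split; last exact: nM.
  split; [by split|move=> Nx; apply: nM; exact: NM Nx].
rewrite /F; case: ifPn => // rq [[[Dx /= qf] _] nM]; split; last exact: nM.
split; first exact: Dx.
exact: lt_trans rq qf.
Qed.

(** * Completed measures: measurable sets modulo null sets *)

Section completion.
Context d (T : measurableType d) (R : realType).
Variable mu : {measure set T -> \bar R}.

(** The outer measure is an infimum over countable covers; the hull intersects the unions of covers
    that are optimal up to [1 / (n + 1)]. *)
Lemma measurable_hull (X : set T) : (mu_ext mu X < +oo)%E ->
  exists F, [/\ measurable F, X `<=` F & mu F = mu_ext mu X].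
Proof.
move=> Xoo.
have ge0 : (0 <= mu_ext mu X)%E by exact: mu_ext_ge0.
have Xfin : mu_ext mu X \is a fin_num by rewrite ge0_fin_numE.
have cover (n : nat) : exists F, [/\ measurable F, X `<=` F &
    (mu F <= mu_ext mu X + n.+1%:R^-1%:E)%E].
  have n0 : 0 < n.+1%:R^-1 :> R by rewrite invr_gt0.
  have [_ [/= A [mA XA] <-] Alt] := lb_ereal_inf_adherent n0 Xfin.
  exists (\bigcup_k A k); split => //; first exact: bigcupT_measurable.
  rewrite (le_trans _ (ltW Alt))//.
  by apply: measure_sigma_subadditive => //; exact: bigcupT_measurable.
pose F n := projT1 (cid (cover n)).
have FP n : [/\ measurable (F n), X `<=` F n &
    (mu (F n) <= mu_ext mu X + n.+1%:R^-1%:E)%E] by rewrite /F; case: cid.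
have mF : measurable (\bigcap_n F n).
  by apply: bigcapT_measurable => n; case: (FP n).
have XF : X `<=` \bigcap_n F n by move=> x Xx n _; case: (FP n) => _ + _; exact.
exists (\bigcap_n F n); split => //; apply/eqP; rewrite eq_le; apply/andP; split.
  apply/lee_addgt0Pr => e e0.
  have [n] := ltr_add_invr e0; rewrite add0r => ne.
  have [mFn _ Fn] := FP n.
  apply: (@le_trans _ _ (mu (F n))).
    by apply: le_measure; rewrite ?inE//; exact: bigcap_inf.
  by rewrite (le_trans Fn)// leeD2l// lee_fin ltW.
by rewrite -(measurable_mu_extE mu mF); apply: le_mu_ext.
Qed.

(** Let [F] be a hull of [A]. Splitting [F] by the Caratheodory criterion and cancelling the finite
    outer measure of [A] shows that the excess of [F] over [A] is null. A hull [G] of this excess is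
    null, and outside [G] the sets [A] and [F] coincide. *)
Lemma caratheodory_measurable_restriction (A : set T) :
  (mu_ext mu A < +oo)%E -> (mu_ext mu).-cara.-measurable A ->
  exists N, [/\ measurable N, mu N = 0%E & measurable (A `\` N)].
Proof.
move=> Aoo mA.
have [F [mF AF FA]] := measurable_hull Aoo.
have mF' : (mu_ext mu).-cara.-measurable F by exact: caratheodory_measurable_mu_ext.
have FA0 : mu_ext mu (F `\` A) = 0%E.
  have : (mu_ext mu F = mu_ext mu A + mu_ext mu (F `\` A))%E.
    by rewrite -{1}(setIidr AF) setDE; exact: mA F.
  rewrite (measurable_mu_extE mu mF) FA -[LHS]adde0.
  have /fineK <- : mu_ext mu A \is a fin_num by rewrite ge0_fin_numE// mu_ext_ge0.
  by case: (mu_ext mu (F `\` A)) => [r [] /addrI <-||].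
have [|G [mG FG G0]] := @measurable_hull (F `\` A); first by rewrite FA0 ltry.
exists G; split => //; first by rewrite G0.
rewrite (_ : A `\` G = F `\` G); first exact: measurableD.
apply/seteqP; split => x [Ax nG]; split => //; first exact: AF.
by apply: contrapT => nA; apply: nG; exact: FG.
Qed.

End completion.

(** On the line [A] may have infinite measure. The completed sigma-algebra consists of unions of a
    Borel set and a subset of a Borel null set, and that null set is removed. *)
Lemma lebesgue_measurable_restriction (R : realType) (A : set (lebT R)) :
  measurable A -> exists N : set R, [/\ measurable N, lebesgue_measure N = 0%E &
    measurable (A `\` N : set R)].
Proof.
move=> mA.
have : (@completed_algebra_gen _ _ R (@lebesgue_measure R)).-sigma.-measurable A.
  by rewrite completed_caratheodory_measurable.
rewrite g_sigma_completed_algebra_genE => -[X mX [M [N [mN N0 MN]] <-]].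
exists N; split => //.
rewrite (_ : _ `\` N = X `\` N); first exact: measurableD.
apply/seteqP; split => x [] => [[Xx|Mx] nN|Xx nN]; split => //; last by left.
by exfalso; apply: nN; exact: MN.
Qed.

(** * Borel Lebesgue measure on the unit interval *)

Section unit_interval.
Variable R : realType.

(** The Borel counterpart of [leb01]; it is a probability, so the preceding estimates apply to it
    and to its product. *)
Definition unit_lebesgue : set (measurableTypeR R) -> \bar R :=
  mrestr (@lebesgue_measure R) (measurable_itv `[(0 : R), 1]).

HB.instance Definition _ := Measure.on unit_lebesgue.

Let unit_lebesgue_setT : unit_lebesgue setT = 1%E.
Proof.
rewrite /unit_lebesgue /mrestr setTI lebesgue_measure_itv/= lte_fin ltr01.
by rewrite oppr0 adde0.
Qed.

HB.instance Definition _ :=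
  @Measure_isProbability.Build _ _ R unit_lebesgue unit_lebesgue_setT.

End unit_interval.
Arguments unit_lebesgue : clear implicits.

(** * Null sets and integrals: from the completed spaces to the Borel ones *)

Section transfer_to_borel.
Variable R : realType.
Notation B := (measurableTypeR R).
Notation P := (unit_lebesgue R).
Notation U := (@unit_itv R).
Notation U2 := (U `*` U).

Lemma measurable_unit_borel : measurable (U : set B).
Proof. exact: measurable_itv. Qed.

Lemma unit_lebesgue_null (N : set B) :
  measurable N -> lebesgue_measure N = 0%E -> P N = 0%E.
Proof.
move=> mN; apply: subset_measure0 => //.
by apply: measurableI => //; exact: measurable_itv.
Qed.

Lemma measurable_unit_square : measurable (U2 : set (B * B)).
Proof. by apply: measurableX; exact: measurable_unit_borel. Qed.

(** Both sides are measures that agree on rectangles, so uniqueness of the product measure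
    applies. *)
Lemma unit_lebesgue_square (N : set (B * B)) : measurable N ->
  (P \x P)%E N = borel2 R (N `&` U2).
Proof.
move=> mN.
have := @product_measure_unique _ _ _ _ R P P
  (mrestr (borel2 R) measurable_unit_square) _ N mN.
apply => A C mA mC; rewrite /= /mrestr.
have -> : A `*` C `&` U2 = (A `&` U) `*` (C `&` U).
  by apply/seteqP; split => -[x y] /= [[? ?] [? ?]].
by rewrite product_measure1E//; apply: measurableI => //; exact: measurable_unit_borel.
Qed.

Lemma ae_unit_itv : {ae P, forall x, U x}.
Proof.
exists (~` U); split => //; first by apply: measurableC; exact: measurable_unit_borel.
by rewrite /= /unit_lebesgue /mrestr setICl measure0.
Qed.

Lemma ae_leb01 (Q : B -> Prop) : {ae P, forall x, Q x} -> {ae leb01 R, forall x, Q x}.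
Proof.
by move=> [N [mN N0 NQ]]; exists N; split => //; exact: sub_caratheodory.
Qed.

(** The exceptional set [N] is only Lebesgue measurable; it is Borel outside a Borel null set [M],
    so adjoining [M] gives a Borel null set that contains it. *)
Lemma ae_borel (Q : B -> Prop) : {ae leb01 R, forall x, Q x} -> {ae P, forall x, Q x}.
Proof.
move=> [N [mN N0 NQ]].
have [M [mM M0 mNM]] := lebesgue_measurable_restriction mN.
exists ((N `\` M) `|` M); split.
- exact: measurableU.
- apply/eqP; rewrite eq_le measure_ge0 andbT.
  rewrite (le_trans (measureU2 _ _ _))// /= /unit_lebesgue /mrestr.
  rewrite (_ : lebesgue_measure (M `&` _) = 0%E) ?adde0.
    by rewrite -N0; apply: le_outer_measure => x [[Nx _] Ix].
  apply/eqP; rewrite eq_le measure_ge0 andbT -M0 le_measure ?inE//.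
  by apply: measurableI => //; exact: measurable_itv.
- by move=> x /NQ Nx; have [Mx|Mx] := pselect (M x); [right|left].
Qed.

(** The guard [U2 z] is there because [leb2] charges the whole plane, while the product of [P] with
    itself charges only the unit square. *)
Lemma ae_leb2 (Q : B * B -> Prop) : {ae (P \x P)%E, forall z, Q z} ->
  {ae leb2 R, forall z, U2 z -> Q z}.
Proof.
move=> [N [mN N0 NQ]].
have mNI : measurable (N `&` U2) by apply: measurableI => //; exact: measurable_unit_square.
exists (N `&` U2); split.
- exact: caratheodory_measurable_mu_ext.
- by rewrite -N0 unit_lebesgue_square//; exact: measurable_mu_extE.
- by move=> z /= /not_implyP[Iz Qz]; split => //; exact: NQ.
Qed.

Lemma ae_product_fst (Q : B -> Prop) : {ae P, forall x, Q x} ->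
  {ae (P \x P)%E, forall z, Q z.1}.
Proof.
move=> [N [mN N0 NQ]]; exists (N `*` setT); split.
- exact: measurableX.
- rewrite product_measure1E// -[RHS](mul0e (P setT)); congr (_ * _)%E.
  exact: N0.
- by move=> z /= Qz; split => //; exact: NQ.
Qed.

Lemma ae_product_snd (Q : B -> Prop) : {ae P, forall x, Q x} ->
  {ae (P \x P)%E, forall z, Q z.2}.
Proof.
move=> [N [mN N0 NQ]]; exists (setT `*` N); split.
- exact: measurableX.
- rewrite product_measure1E// -[RHS](mule0 (P setT)); congr (_ * _)%E.
  exact: N0.
- by move=> z /= Qz; split => //; exact: NQ.
Qed.

(** The measure of the exceptional set is the integral of the measures of its sections; if it is 0,
    almost every section is null. *)
Lemma ae_sections (Q : B * B -> Prop) : {ae (P \x P)%E, forall z, Q z} ->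
  {ae P, forall x, {ae P, forall y, Q (x, y)}}.
Proof.
move=> [N [mN N0 NQ]].
have : (\int[P]_x `|(P \o xsection N) x| = 0)%E.
  by rewrite -[RHS]N0; apply: eq_integral => x _; rewrite gee0_abs.
move/ae_eq_integral_abs => /(_ measurableT (measurable_fun_xsection _ mN)).
apply: filterS => x /= /(_ I) Nx; exists (xsection N x); split => //.
  exact: measurable_xsection.
by move=> y Qy; apply/xsectionP; exact: NQ.
Qed.

Lemma integral_leb01 (f : B -> \bar R) : measurable_fun setT f ->
  (\int[leb01 R]_x f x = \int[P]_x f x)%E.
Proof.
move=> mf; apply/esym/(integral_comp_measure (phi := idfun : lebT R -> B)) => //.
by move=> _ C mC; rewrite setTI; exact: sub_caratheodory.
Qed.

Lemma integral_leb2 (f : B * B -> \bar R) : measurable_fun setT f ->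
  (forall z, ~ U2 z -> f z = 0%E) ->
  (\int[leb2 R]_z f z = \int[P \x P]_z f z)%E.
Proof.
move=> mf f0.
have fI : f \_ U2 = f.
  apply/funext => z; rewrite /patch; case: ifPn => //; rewrite notin_setE => /f0 ->//.
rewrite -[in RHS]fI -integral_mkcond.
rewrite (@eq_measure_integral _ _ _ _ (borel2 R)); last first.
  by move=> A mA AI; rewrite [LHS]unit_lebesgue_square// setIidl.
rewrite [RHS]integral_mkcond fI.
apply/esym/(integral_comp_measure (phi := idfun : leb2T R -> B * B)).
- by move=> _ C mC; rewrite setTI; exact: caratheodory_measurable_mu_ext.
- by move=> C mC; rewrite [RHS]measurable_mu_extE.
- exact: mf.
Qed.

End transfer_to_borel.

Lemma measurable_patch d (X : measurableType d) (R : realType) (D : set X)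
    (f : X -> R) : measurable D ->
  (forall r, measurable (D `&` [set x | r < f x])) ->
  measurable_fun setT (f \_ D).
Proof.
move=> mD mf; apply/(measurable_restrictT _ _).1 => //.
apply: (measurability _ (RGenOInfty.measurableE R)) => _ [_ [r ->] <-].
rewrite (_ : _ `&` _ = D `&` [set x | r < f x]); first exact: mf.
by apply/seteqP; split => x /=; rewrite in_itv/= andbT.
Qed.

(** * Borel representatives of graphons, test functions and test sets *)

Section borel_representatives.
Variable R : realType.
Notation B := (measurableTypeR R).
Notation P := (unit_lebesgue R).
Notation U := (@unit_itv R).
Notation U2 := (U `*` U).

(** Off one Borel null set all superlevel sets of [W] in the square are Borel. Setting [W] to 0 on a
    null set containing it and outside the square makes the bounds hold everywhere. *)
Lemma graphon_representative (W : graphon R) : exists w : B * B -> R,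
  symmetric_kernel w /\ {ae (P \x P)%E, forall z, U2 z -> W z = w z}.
Proof.
have mU2 : measurable (U2 : set (B * B)) := @measurable_unit_square R.
have U2oo : (mu_ext (borel2 R) U2 < +oo)%E.
  have e : (P \x P)%E setT = borel2 R U2.
    by rewrite (@unit_lebesgue_square R setT measurableT) setTI.
  rewrite measurable_mu_extE//; apply: le_lt_trans (ltry (1 : R)).
  by rewrite -[leLHS]/(borel2 R U2) -e; exact: probability_le1.
have [N [mN N0 NP]] : exists N : set (B * B), [/\ measurable N, borel2 R N = 0%E &
    forall r, measurable ((U2 `&` [set z | r < W z]) `\` N)].
  apply: ae_measurable_restriction => r.
  apply: caratheodory_measurable_restriction.
    by apply: le_lt_trans U2oo; apply: le_mu_ext; exact: subIsetl.
  have := @graphon_measurable _ W (caratheodory_measurable_mu_ext _ mU2)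
    `]r, +oo[%classic (measurable_itv _).
  by rewrite preimage_itvoy.
pose sw (z : B * B) : B * B := (z.2, z.1).
have mswap : measurable_fun setT sw := @measurable_swap _ _ B B.
(* Adding the mirror image makes the removed set symmetric, so the representative is symmetric at
   every point. *)
pose M := N `|` (sw @^-1` N).
have mM : measurable M.
  by apply: measurableU => //; rewrite -[X in measurable X]setTI; exact: mswap.
have PN0 : (P \x P)%E N = 0%E.
  apply/eqP; rewrite eq_le measure_ge0 andbT -N0 unit_lebesgue_square//.
  by rewrite le_measure ?inE//; exact: measurableI.
have mN' : measurable (sw @^-1` N) by rewrite -[X in measurable X]setTI; exact: mswap.
have swN0 : (P \x P)%E (sw @^-1` N) = 0%E.
  have : (\int[P \x P]_z (\1_(sw @^-1` N) z)%:E = \int[P \x P]_z (\1_N z)%:E)%E.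
    apply: (@ge0_integral_swap _ B R P (fun z => (\1_N z)%:E)) => [|z].
      by apply/measurable_EFinP; exact: measurable_indic.
    by rewrite lee_fin.
  rewrite !integral_indic// !setIT => h; exact: (etrans h PN0).
have M0 : (P \x P)%E M = 0%E.
  by apply/negligibleP => //; apply: negligibleU; apply/negligibleP.
exists (W \_ (U2 `\` M)); split; last first.
  exists M; split => // z /= /not_implyP[Uz]; apply: contra_notP => Mz.
  by rewrite /patch mem_set.
split.
- apply: measurable_patch => [|r]; first exact: measurableD.
  rewrite (_ : _ `&` _ = ((U2 `&` [set z | r < W z]) `\` N) `&` ~` M).
    by apply: measurableI; [exact: NP|exact: measurableC].
  apply/seteqP; split => z.
    by move=> [[Uz Mz] rz]; split=> //; split => // Nz; apply: Mz; left.
  by move=> [[[Uz rz] Nz] Mz]; split.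
- move=> [x y]; rewrite /patch; case: ifPn; last by rewrite lexx ler01.
  by rewrite inE => -[[Ux Uy] _]; exact: graphon_range.
- move=> x y; rewrite /patch.
  have E : ((x, y) \in U2 `\` M) = ((y, x) \in U2 `\` M).
    by apply/idP/idP; rewrite !inE => -[[Ux Uy] Mxy]; split => //;
      apply: contra_not Mxy => -[]; [right|left|right|left].
  rewrite -E; case: ifPn => //; rewrite inE => -[[Ux Uy] _].
  exact: graphon_sym.
Qed.

Section one_graphon.
Variables (W : graphon R) (w : B * B -> R).
Hypotheses (kw : symmetric_kernel w)
  (Ww : {ae (P \x P)%E, forall z, U2 z -> W z = w z}).

(** For almost every [x] the sections of [W] and [w] agree almost everywhere, and the integral sees
    a section only up to null sets. *)
Lemma degree_ae : {ae P, forall x, degree W x = deg P w x}.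
Proof.
move: (ae_sections Ww) (ae_unit_itv R); apply: filterS2 => x Wx Ux.
rewrite /degree /deg /Rintegral; congr fine.
have mwx : measurable_fun setT (fun y : B => (w (x, y))%:E).
  by apply/measurable_EFinP; case: kw => mw _ _; exact: measurableT_comp.
rewrite -integral_leb01//; apply: ae_eq_integral_nonmeasurable.
have FF : Filter (almost_everywhere (leb01 R)) by exact: ae_filter_ringOfSetsType.
move: (ae_leb01 Wx) (ae_leb01 (ae_unit_itv R)); apply: filterS2 => y Wxy Uy.
by rewrite Wxy.
Qed.

Lemma normalized_kernel_ae :
  {ae (P \x P)%E, forall z, U2 z -> normalized_kernel W z = nker P w z}.
Proof.
have FF : Filter (almost_everywhere (P \x P)%E) by exact: ae_filter_ringOfSetsType.
move: Ww (ae_product_fst degree_ae) (ae_product_snd degree_ae).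
apply: filterS3 => z Wz d1 d2 Uz.
rewrite /normalized_kernel /nker d1 d2 Wz//.
rewrite sqrtrM; last exact: deg_ge0.
(* The explicit case of a vanishing degree in [normalized_kernel] matches the division by 0 in
   [nker]. *)
have [->|d10] := eqVneq (deg P w z.1) 0; first by rewrite sqrtr0 mul0r invr0 mulr0.
by have [->|d20] //= := eqVneq (deg P w z.2) 0; rewrite sqrtr0 mulr0 invr0 mulr0.
Qed.

End one_graphon.

Lemma lebesgue_representative (f : lebT R -> R) : measurable_fun setT f ->
  exists N : set B, [/\ measurable N, lebesgue_measure N = 0%E &
    measurable_fun setT (f \_ (~` N) : B -> R)].
Proof.
move=> mf.
have [N [mN N0 NP]] : exists N : set B, [/\ measurable N, lebesgue_measure N = 0%E &
    forall r, measurable ((setT `&` [set z | r < f z]) `\` N : set B)].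
  apply: ae_measurable_restriction => r.
  apply: lebesgue_measurable_restriction.
  have := mf measurableT `]r, +oo[%classic (measurable_itv _).
  by rewrite preimage_itvoy.
exists N; split => //; apply: measurable_patch => [|r]; first exact: measurableC.
by have := NP r; rewrite setTI setDE setIC.
Qed.

(** The function is set to 0 on two null sets: where it fails to be Borel and where the bound fails.
    The bound then holds everywhere, as the weights of [normalized_limit] require. *)
Lemma unit_bounded_representative (f : lebT R -> R) : measurable_fun setT f ->
  {ae leb01 R, forall x, `|f x| <= 1} ->
  exists g : B -> R, [/\ measurable_fun setT g, (forall x, `|g x| <= 1) &
    {ae P, forall x, f x = g x}].
Proof.
move=> mf /ae_borel[M [mM M0 fM]].
have [N [mN N0 mfN]] := lebesgue_representative mf.
exists ((f \_ (~` N)) \_ (~` M)); split.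
- by apply/(measurable_restrictT _ _).1; [exact: measurableC|exact: measurable_funTS].
- move=> x; rewrite /patch; case: ifPn => xM; last by rewrite normr0.
  case: ifPn => _; last by rewrite normr0.
  by move: xM; rewrite inE => xM; apply: contrapT => fx; apply: xM; exact: fM.
- have PN0 := unit_lebesgue_null mN N0.
  exists (M `|` N); split; first exact: measurableU.
    apply/negligibleP; first exact: measurableU.
    by apply: negligibleU; apply/negligibleP.
  move=> x /=; apply: contra_notP => /not_orP[xM xN].
  by rewrite /patch !mem_set.
Qed.

Lemma lebesgue_set_representative (A : set (lebT R)) : measurable A ->
  exists A' : set B, measurable A' /\ {ae P, forall x, A x <-> A' x}.
Proof.
move=> /lebesgue_measurable_restriction[N [mN N0 mAN]].
exists (A `\` N); split => //; exists N; split => //.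
  exact: unit_lebesgue_null.
move=> x /=; apply: contra_notP => Nx.
by split => [|[]].
Qed.

Lemma integral_leb2_rectangle (A C : set (lebT R)) (A' C' : set B)
    (F f : B * B -> R) :
  A `<=` U -> C `<=` U -> measurable A' -> measurable C' ->
  {ae P, forall x, A x <-> A' x} -> {ae P, forall x, C x <-> C' x} ->
  measurable_fun setT f -> {ae (P \x P)%E, forall z, U2 z -> F z = f z} ->
  (\int[leb2 R]_(z in A `*` C) (F z)%:E =
   \int[P \x P]_z (\1_A' z.1 * \1_C' z.2 * f z)%:E)%E.
Proof.
move=> AU CU mA' mC' AA' CC' mf Ff.
have mU : measurable (U : set B) := @measurable_unit_borel R.
(* Intersecting with [U] makes [g] vanish off the square, as [integral_leb2] demands; under the
   product of [P] with itself the intersection has no effect almost everywhere. *)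
pose g (z : B * B) : R := \1_(A' `&` U) z.1 * \1_(C' `&` U) z.2 * f z.
have mind (E : set B) : measurable E -> measurable_fun setT (\1_E : B -> R).
  by move=> mE; exact: measurable_indic.
have mg : measurable_fun setT (EFin \o g).
  apply/measurable_EFinP; apply: measurable_funM => //; apply: measurable_funM.
    by apply: measurable_comp_fst; apply: mind; exact: measurableI.
  by apply: measurable_comp_snd; apply: mind; exact: measurableI.
transitivity (\int[leb2 R]_z (EFin \o g) z)%E.
  rewrite integral_mkcond; apply: ae_eq_integral_nonmeasurable.
  have : {ae (P \x P)%E, forall z, U2 z -> F z = f z /\
      (A z.1 <-> A' z.1) /\ (C z.2 <-> C' z.2)}.
    have FF : Filter (almost_everywhere (P \x P)%E) by exact: ae_filter_ringOfSetsType.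
    move: Ff (ae_product_fst AA') (ae_product_snd CC').
    by apply: filterS3 => z ? ? ? ?; split; [auto|].
  have FL : Filter (almost_everywhere (leb2 R)) by exact: ae_filter_ringOfSetsType.
  move/ae_leb2; apply: filterS => -[x y] h.
  rewrite /patch /g /=; case: ifPn.
    rewrite inE => -[/= Ax Cy]; have Ux := AU _ Ax; have Uy := CU _ Cy.
    have [-> [AA CC]] := h (conj Ux Uy) (conj Ux Uy).
    have [A'x C'y] : A' x /\ C' y by split; [exact/AA|exact/CC].
    by rewrite !indicE !mem_set// !mul1r.
  rewrite notin_setE => nAC; rewrite /g/=.
  have [[Ux Uy]|nU] := pselect (U2 (x, y)).
    have [_ [AA CC]] := h (conj Ux Uy) (conj Ux Uy).
    have [A'x|A'x] := pselect (A' x); last first.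
      by rewrite !indicE memNset ?mul0r// => -[].
    rewrite [X in _ * X * _]indicE memNset ?mulr0 ?mul0r// => -[C'y _].
    by apply: nAC; split; [exact/AA|exact/CC].
  have [Ux|Ux] := pselect (U x); last first.
    by rewrite !indicE memNset ?mul0r// => -[].
  by rewrite [X in _ * X * _]indicE memNset ?mulr0 ?mul0r// => -[_ Uy]; apply: nU.
rewrite integral_leb2//; last first.
  move=> [x y] nU; rewrite /g/=.
  have [Ux|Ux] := pselect (U x); last first.
    by rewrite !indicE memNset ?mul0r// => -[].
  by rewrite [X in _ * X * _]indicE memNset ?mulr0 ?mul0r// => -[_ Uy]; apply: nU.
apply: ae_eq_integral_nonmeasurable.
have FF : Filter (almost_everywhere (P \x P)%E) by exact: ae_filter_ringOfSetsType.
move: (ae_product_fst (ae_unit_itv R)) (ae_product_snd (ae_unit_itv R)).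
apply: filterS2 => z Uz1 Uz2; rewrite /g /=; congr (_ * _ * _)%:E.
  by rewrite !indicE in_setI [X in _ && X]mem_set ?andbT.
by rewrite !indicE in_setI [X in _ && X]mem_set ?andbT.
Qed.

End borel_representatives.

(** * Cut norm, operator norm and Laplacians of graphons through their representatives *)

Section limits_of_graphons.
Variable R : realType.
Notation B := (measurableTypeR R).
Notation P := (unit_lebesgue R).
Notation U := (@unit_itv R).
Notation U2 := (U `*` U).

Lemma cvge0P (u : nat -> \bar R) : (forall n, 0 <= u n)%E ->
  u @ \oo --> 0%E <-> forall e : R, 0 < e -> \forall n \near \oo, (u n <= e%:E)%E.
Proof.
move=> u0; split=> [/fine_cvgP[fu /cvgrPdist_le ue] e e0|ue].
  move: fu (ue _ e0); apply: filterS2 => n fn; rewrite sub0r normrN => ne.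
  by rewrite -(fineK fn) lee_fin (le_trans (ler_norm _)).
have fin n e : (u n <= e%:E)%E -> u n \is a fin_num.
  by move=> ne; rewrite ge0_fin_numE// (le_lt_trans ne)// ltry.
apply/fine_cvgP; split; first by apply: filterS (ue _ ltr01) => n /fin.
apply/cvgrPdist_le => e e0; apply: filterS (ue _ e0) => n ne.
by rewrite sub0r normrN ger0_norm ?fine_ge0// -lee_fin fineK// (fin _ _ ne).
Qed.

Lemma cut_norm_ge0 (V : R * R -> R) : (0 <= cut_norm V)%E.
Proof.
apply: (@le_trans _ _ `| \int[leb2 R]_(z in set0 `*` set0) (V z)%:E |%E) => //.
by apply: ereal_sup_ubound; exists set0, set0; split.
Qed.

Lemma opnorm_ge0 (L : (R -> R) -> R -> R) : (0 <= opnorm_infty_1 L)%E.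
Proof.
apply: (@le_trans _ _ (Lnorm (leb01 R) 1 (EFin \o (L (cst 0) : lebT R -> R)))).
  exact: Lnorm_ge0.
apply: ereal_sup_ubound; exists (cst 0) => //.
have N0 : Lnorm (leb01 R) +oo (EFin \o (cst 0%R : lebT R -> R)) = 0%E.
  exact: Lnorm0.
have N1 : (Lnorm (leb01 R) +oo (EFin \o (cst 0%R : lebT R -> R)) <= 1)%E by rewrite N0.
have Noo : (Lnorm (leb01 R) +oo (EFin \o (cst 0%R : lebT R -> R)) < +oo)%E.
  by rewrite N0 ltry.
split; last exact: N1.
rewrite inE; apply/andP; split; first by rewrite inE; exact: measurable_cst.
by rewrite inE; exact: Noo.
Qed.

Lemma leb01_setT : leb01 R setT = 1%E.
Proof. by rewrite -[RHS](@probability_setT _ _ _ P). Qed.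

Lemma Lnorm_infty_le1 (f : lebT R -> R) :
  (Lnorm (leb01 R) +oo (EFin \o f) <= 1)%E -> {ae leb01 R, forall x, `|f x| <= 1}.
Proof.
(* The norm at [+oo] is the essential supremum only on a space of positive mass, hence the appeal to
   [leb01_setT]. *)
rewrite unlock /Lnorm leb01_setT lte01 => /ess_supP.
have FF : Filter (almost_everywhere (leb01 R)) by exact: ae_filter_ringOfSetsType.
by apply: filterS => x; rewrite /= lee_fin.
Qed.

(** This supplies the cut hypothesis for the representatives. Arbitrary Borel sets are intersected
    with the unit interval to become admissible in [cut_norm]. *)
Lemma cut_norm_ge_borel (W W0 : graphon R) (w w0 : B * B -> R) (A C : set B) :
  symmetric_kernel w -> symmetric_kernel w0 ->
  {ae (P \x P)%E, forall z, U2 z -> W z = w z} ->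
  {ae (P \x P)%E, forall z, U2 z -> W0 z = w0 z} ->
  measurable A -> measurable C ->
  (`|\int[(P \x P)%E]_z (\1_A z.1 * \1_C z.2 * (w z - w0 z))|%:E
    <= cut_norm (fun z => W z - W0 z)%R)%E.
Proof.
move=> kw kw0 Ww Ww0 mA mC.
have [mw w01 _] := kw; have [mw0 w001 _] := kw0.
have mU : measurable (U : set B) := @measurable_unit_borel R.
have mww0 : measurable_fun setT (fun z : B * B => w z - w0 z).
  exact: measurable_funB.
have FF : Filter (almost_everywhere (P \x P)%E) by exact: ae_filter_ringOfSetsType.
have FP : Filter (almost_everywhere P) by exact: ae_filter_ringOfSetsType.
have aeU (D : set B) : {ae P, forall x, (D `&` U) x <-> D x}.
  by apply: filterS (ae_unit_itv R) => x Ux; split=> [[]|].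
have aeW : {ae (P \x P)%E, forall z, U2 z -> W z - W0 z = w z - w0 z}.
  by move: Ww Ww0; apply: filterS2 => z e e0 Uz; rewrite e// e0.
rewrite EFin_normr_Rintegral//; last first.
  apply: (@integrable_bounded _ _ _ _ _ 1).
    apply: measurable_funM => //; apply: measurable_funM.
      by apply: measurable_comp_fst; exact: measurable_indic.
    by apply: measurable_comp_snd; exact: measurable_indic.
  move=> z; rewrite !normrM !indicE; case/andP: (w01 z) => ? ?; case/andP: (w001 z) => ? ?.
  have ? : `|w z - w0 z| <= 1 by rewrite ler_norml; apply/andP; split; lra.
  by case: (_ \in _); case: (_ \in _); rewrite ?normr1 ?normr0 ?mul1r ?mul0r.
rewrite -(integral_leb2_rectangle (A := A `&` U) (C := C `&` U) _ _ mA mC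
  (aeU A) (aeU C) mww0 aeW); [|exact: subIsetr|exact: subIsetr].
apply: ereal_sup_ubound; exists (A `&` U), (C `&` U); split.
- by apply: sub_caratheodory; exact: measurableI.
- exact: subIsetr.
- by apply: sub_caratheodory; exact: measurableI.
- exact: subIsetr.
- by [].
Qed.

Lemma normalized_laplacian_ae (W W0 : graphon R) (w w0 : B * B -> R)
    (f : lebT R -> R) (g : B -> R) :
  symmetric_kernel w -> symmetric_kernel w0 ->
  {ae (P \x P)%E, forall z, U2 z -> W z = w z} ->
  {ae (P \x P)%E, forall z, U2 z -> W0 z = w0 z} ->
  measurable_fun setT g -> (forall x, `|g x| <= 1) ->
  {ae P, forall x, f x = g x} ->
  {ae P, forall x, normalized_laplacian W f x - normalized_laplacian W0 f x =
    laplacian_diff P w w0 g x}.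
Proof.
move=> kw kw0 Ww Ww0 mg g1 fg.
have FP : Filter (almost_everywhere P) by exact: ae_filter_ringOfSetsType.
have FL : Filter (almost_everywhere (leb01 R)) by exact: ae_filter_ringOfSetsType.
(* Each Laplacian is identified separately; integrability of the section is recorded because the two
   integrals are merged at the end. *)
have term (V : graphon R) (v : B * B -> R) : symmetric_kernel v ->
    {ae (P \x P)%E, forall z, U2 z -> V z = v z} ->
    {ae P, forall x, P.-integrable setT (fun y => (g y * nker P v (x, y))%:E) /\
      normalized_laplacian V f x = (deg P v x != 0)%:R * g x -
        \int[P]_y (g y * nker P v (x, y))}.
  move=> kv Vv; have mn := measurable_nker P kv.
  have [inv _ _] := Rintegral_fubini1 (integrable_nker P kv).
  have nVv := ae_sections (normalized_kernel_ae kv Vv).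
  have dVv := degree_ae kv Vv.
  near=> x; split.
    apply: (integrable_mul_bounded (K := 1) mg g1).
    by near: x.
  have dx : degree V x = deg P v x by near: x.
  have fx : f x = g x by near: x.
  have Ux : U x by near: x; exact: ae_unit_itv.
  have nx : {ae P, forall y, U2 (x, y) -> normalized_kernel V (x, y) = nker P v (x, y)}.
    by near: x.
  rewrite /normalized_laplacian dx fx; congr (_ - _).
  rewrite /Rintegral; congr fine; rewrite -integral_leb01; last first.
    apply/measurable_EFinP; apply: measurable_funM => //.
    exact: measurableT_comp.
  apply: ae_eq_integral_nonmeasurable.
  move: (ae_leb01 nx) (ae_leb01 fg) (ae_leb01 (ae_unit_itv R)).
  by apply: filterS3 => y nxy fy Uy; rewrite nxy// fy mulrC.
move: (term _ _ kw Ww) (term _ _ kw0 Ww0); apply: filterS2 => x [i ->] [i0 ->].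
rewrite /laplacian_diff.
under [in RHS]eq_Rintegral do rewrite mulrC mulrBr.
rewrite (RintegralB measurableT i i0).
move: (\int[P]_y _) (\int[P]_y _) => a b; ring.
Unshelve. all: by end_near. Qed.

End limits_of_graphons.

Theorem theorem2 (R : realType) (W : nat -> graphon R) (W0 : graphon R) :
  cut_norm (fun z => W n z - W0 z) @[n --> \oo] --> 0%E ->
  {ae leb01 R, forall x, unit_itv x -> 0 < degree W0 x} ->
  cut_norm (fun z => normalized_kernel (W n) z - normalized_kernel W0 z)
    @[n --> \oo] --> 0%E /\
  opnorm_infty_1 (fun f x =>
      normalized_laplacian (W n) f x - normalized_laplacian W0 f x)
    @[n --> \oo] --> 0%E.
Proof.
move=> cutW deg0.
pose P := unit_lebesgue R; pose B := measurableTypeR R.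
have /choice[w wP] n := graphon_representative (W n).
have [w0 [kw0 Ww0]] := graphon_representative W0.
have kw n : symmetric_kernel (w n) by case: (wP n).
have Ww n := (wP n).2.
(* One rank [n] must serve all Borel sets at once; the supremum in [cut_norm] provides this
   uniformity. *)
have cut0 c : 0 < c -> \forall n \near \oo, forall A C : set B,
    measurable A -> measurable C ->
    `|\int[(P \x P)%E]_z (\1_A z.1 * \1_C z.2 * (w n z - w0 z))| <= c.
  move=> c0; move/(cvge0P (fun n => cut_norm_ge0 _))/(_ c c0) : cutW.
  apply: filterS => n cn A C mA mC; rewrite -lee_fin; apply: le_trans cn.
  exact: cut_norm_ge_borel.
have FP : Filter (almost_everywhere P) by exact: ae_filter_ringOfSetsType.
have FPP : Filter (almost_everywhere (P \x P)%E) by exact: ae_filter_ringOfSetsType.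
have FL : Filter (almost_everywhere (leb01 R)) by exact: ae_filter_ringOfSetsType.
have deg0' : {ae P, forall x, 0 < deg P w0 x}.
  move: (ae_borel deg0) (degree_ae kw0 Ww0) (ae_unit_itv R).
  by apply: filterS3 => x d0 <- /d0.
have lim := normalized_limit kw kw0 cut0 deg0'.
split; (apply/cvge0P => [n|e e0]).
- exact: cut_norm_ge0.
- apply: filterS (lim e e0) => n [le_e _].
  apply: ge_ereal_sup => _ [A [C [mA AU mC CU ->]]].
  (* The indicators of Borel versions of the test sets are the weights [s] and [f] of
     [normalized_limit]. *)
  have [A' [mA' AA']] := lebesgue_set_representative mA.
  have [C' [mC' CC']] := lebesgue_set_representative mC.
  rewrite (integral_leb2_rectangle (A' := A') (C' := C')
    (f := fun z => nker P (w n) z - nker P w0 z))//; last 2 first.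
  + by apply: measurable_funB; exact: measurable_nker.
  + move: (normalized_kernel_ae (kw n) (Ww n)) (normalized_kernel_ae kw0 Ww0).
    by apply: filterS2 => z nz n0z Uz; rewrite nz// n0z.
  have ind1 (D : set B) x : `|\1_D x| <= 1 :> R.
    by rewrite indicE; case: (_ \in _); rewrite ?normr1 ?normr0.
  have mind (D : set B) : measurable D -> measurable_fun setT (\1_D : B -> R).
    by move=> mD; exact: measurable_indic.
  rewrite -EFin_normr_Rintegral ?lee_fin//.
    by apply: le_e => //; exact: mind.
  apply: (integrable_mul_bounded (K := 1)
    (s := fun z : B * B => \1_A' z.1 * \1_C' z.2)).
  + by apply: measurable_funM; [exact: measurable_comp_fst (mind _ mA')|
      exact: measurable_comp_snd (mind _ mC')].
  + by move=> z; rewrite normrM mulr_ile1.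
  + by apply: integrable_EFinB; exact: integrable_nker.
- exact: opnorm_ge0.
- apply: filterS (lim e e0) => n [_ le_e].
  apply: ge_ereal_sup => _ [f [/= fL /Lnorm_infty_le1 f1] <-].
  have mf : measurable_fun setT (f : lebT R -> R).
    by have := sub_Lfun_mfun fL; rewrite inE.
  (* A test function in the unit ball is bounded by 1 only almost everywhere; [g] is Borel and
     bounded by 1 at every point. *)
  have [g [mg g1 fg]] := unit_bounded_representative mf f1.
  have [ild ld] := le_e g mg g1.
  have -> : Lnorm (leb01 R) 1 (EFin \o ((fun x => normalized_laplacian (W n) f x -
      normalized_laplacian W0 f x) : lebT R -> R)) =
      (\int[P]_x (`|laplacian_diff P (w n) w0 g x|)%:E)%E.
    rewrite Lnorm1 -integral_leb01; last first.
      by apply/measurable_EFinP; apply: measurableT_comp => //;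
        apply/measurable_EFinP; exact: measurable_int ild.
    apply: ae_eq_integral_nonmeasurable.
    have := normalized_laplacian_ae (kw n) kw0 (Ww n) Ww0 mg g1 fg.
    by move/ae_leb01; apply: filterS => x /= ->.
  rewrite -lee_fin /Rintegral fineK// in ld.
  exact: integrable_fin_num (integrable_norm ild).
Qed.
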